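(* Let $L_1\ge 2$ and $K_n,M_n\ge 2$ ($n\ge1$) be integers, put $L_{n+1}=L'(L_n,M_n,K_n)$ for $n\ge1$, and suppose that $\varinjlim(\tilde Z_{L_n,L_n+1},\Phi_{L_n,L_{n+1}})\cong\mathcal Z$, where $\Phi_{L_n,L_{n+1}}$ is the $^*$-homomorphism associated with $(L_n,M_n,K_n)$ as in the context. Let $$\tilde D:=\varinjlim\big(\tilde D_{L_n,L_n+1},\Phi_{L_n,L_{n+1}}|_{\tilde D_{L_n,L_n+1}}\big)\subset\mathcal Z .$$ Then the spectrum $X$ of the commutative $\mathrm C^*$-algebra $\tilde D$ is not locally connected.
   Context: $\mathcal Z$ is the Jiang--Su algebra, i.e. the unique simple unital infinite-dimensional $\mathrm C^*$-algebra with a unique tracial state that is an inductive limit of prime dimension drop algebras with unital connecting maps. A topological space is not locally connected if there is a point in it that does not admit a neighbourhood base of connected sets. Building blocks. For an integer $L\ge 2$, $\tilde Z_{L,L+1}$ is the universal unital $\mathrm C^*$-algebra generated by $c_1,\dots,c_L,s$ subject to the relations, for $1\le i\ne j\le L$: $c_1\ge 0$, $c_ic_i^*=c_1^2$, $c_i^*c_i\perp c_j^*c_j$, $c_1s=s$, $\sum_{l=1}^L c_l^*c_l+s^*s=1$. It is known to be isomorphic to the dimension drop algebra $\{f\in C([0,1],\mathbb M_L\otimes\mathbb M_{L+1}): f(0)\in\mathbb M_L\otimes 1_{L+1},\ f(1)\in 1_L\otimes\mathbb M_{L+1}\}$. Put $$\tilde D_{L,L+1}=\mathrm C^*\big(c_i^*c_i,\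 s^*s,\ c_i^*ss^*c_i,\ c_j^*s\,c_i^*c_i\,s^*c_j : 1\le i,j\le L\big)\subset\tilde Z_{L,L+1},$$ an abelian subalgebra. Connecting maps. Let $L,M,K\ge 2$ be integers and put $K'=KML$, $L'=L'(L,M,K)=KML^2+ML$. Write $\bar c_1,\dots,\bar c_L,\bar s$ for the generators of $\tilde Z_{L,L+1}$ and $c_1,\dots,c_{L'},s$ for those of $\tilde Z_{L',L'+1}$. Let $\Psi:C_0((0,1])\otimes\mathbb M_{L'}\to\tilde Z_{L',L'+1}$ be the $^*$-homomorphism with $\Psi(\mathrm{id}^{1/2}\otimes e_{1,i})=c_i$ for $1\le i\le L'$, and $\Theta:C_0((0,1])\otimes\mathbb M_2\to\tilde Z_{L',L'+1}$ the $^*$-homomorphism with $\Theta(\mathrm{id}^{1/2}\otimes e_{1,2})=s$ (these exist by the relations). Let $g,h\in C_0((0,1])$ be $g(t)=\min\{4t,1\}$ and $h(t)=\max\{0,4(t-\tfrac34)\}$. For $1\le l\le L$ set $$\tilde c_l=\sum_{i=1}^{K'}\Psi\big(g^{1/2}\otimes e_{i,(l-1)(K'+M)+i}\big)+\sum_{i=1}^{M}\Psi\big((g-\tfrac iMh)^{1/2}\otimes e_{K'+i,\,lK'+(l-1)M+i}\big),$$ $$\tilde s=\Theta\big(h^{1/2}\otimes e_{1,2}\big)+\sum_{l=1}^{L}\sum_{i=1}^{M}\Psi\big((\tfrac iMh)^{1/2}\otimes e_{(l-1)M+i+1,\,lK'+(l-1)M+i}\big).$$ The elements $\tilde c_1,\dots,\tilde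 c_L,\tilde s$ satisfy the defining relations of $\tilde Z_{L,L+1}$, and $\Phi_{L,L'}:\tilde Z_{L,L+1}\to\tilde Z_{L',L'+1}$ is the induced (unital, injective) $^*$-homomorphism with $\Phi_{L,L'}(\bar c_l)=\tilde c_l$ and $\Phi_{L,L'}(\bar s)=\tilde s$ (it depends on $L,M,K$). It satisfies $\Phi_{L,L'}(\tilde D_{L,L+1})\subset\tilde D_{L',L'+1}$. *)

(* Defs.v *)
From HB Require Import structures.
From mathcomp Require Import all_boot all_order all_algebra.
From mathcomp Require Import all_classical all_reals all_analysis.
From mathcomp Require Import complex mxtens.

Set Implicit Arguments.
Unset Strict Implicit.
Unset Printing Implicit Defensive.

Import Order.TTheory GRing.Theory Num.Theory.
Import numFieldNormedType.Exports.

Local Open Scope classical_set_scope.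
Local Open Scope complex_scope.
Local Open Scope ring_scope.

(* R[i] with the topology given by its modulus. *)
HB.instance Definition _ (R : realType) :=
  PseudoPointedMetric.copy R[i] (R[i]^o).

(* Unital C*-algebras over R[i].  The norm takes its values in R[i], as the   *)
(* library requires of a normed module over R[i]; these values are            *)
(* nonnegative reals.  The multiplication is not inherited from algType,      *)
(* because the hierarchy admits no structure above both the rings and the     *)
(* normed modules except the number domains; it is declared here, and the     *)
(* algType structure is derived from it.                                      *)
HB.mixin Record isCStarAlgebra (R : realType) (A : Type)
    & CompleteNormedModule R[i] A := {
  cstar_mul : A -> A -> A ;
  cstar_one : A ;
  cstar_mulA : associative cstar_mul ;
  cstar_mul1r : left_id cstar_one cstar_mul ;
  cstar_mulr1 : right_id cstar_one cstar_mul ;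
  cstar_mulDl : left_distributive cstar_mul +%R ;
  cstar_mulDr : right_distributive cstar_mul +%R ;
  cstar_one_neq0 : cstar_one != 0 ;
  cstar_scaleAl : forall (k : R[i]) (x y : A),
    k *: cstar_mul x y = cstar_mul (k *: x) y ;
  cstar_scaleAr : forall (k : R[i]) (x y : A),
    k *: cstar_mul x y = cstar_mul x (k *: y) ;
  star : A -> A ;
  starD : forall x y : A, star (x + y) = star x + star y ;
  starZ : forall (k : R[i]) (x : A), star (k *: x) = Num.conj k *: star x ;
  starM : forall x y : A, star (cstar_mul x y) = cstar_mul (star y) (star x) ;
  starK : involutive star ;
  cstar_ler_normM : forall x y : A, `|cstar_mul x y| <= `|x| * `|y| ;
  cstar_norm : forall x : A, `|cstar_mul (star x) x| = `|x| ^+ 2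
}.

#[short(type="cstarType")]
HB.structure Definition CStarAlgebra (R : realType) :=
  { A of CompleteNormedModule R[i] A & isCStarAlgebra R A }.

#[non_forgetful_inheritance]
HB.instance Definition _ (R : realType) (A : cstarType R) :=
  GRing.Zmodule_isNzRing.Build (CStarAlgebra.sort A) cstar_mulA cstar_mul1r
    cstar_mulr1 cstar_mulDl cstar_mulDr cstar_one_neq0.

#[non_forgetful_inheritance]
HB.instance Definition _ (R : realType) (A : cstarType R) :=
  GRing.Lmodule_isLalgebra.Build R[i] (CStarAlgebra.sort A) cstar_scaleAl.

#[non_forgetful_inheritance]
HB.instance Definition _ (R : realType) (A : cstarType R) :=
  GRing.Lalgebra_isAlgebra.Build R[i] (CStarAlgebra.sort A) cstar_scaleAr.

Section CStar.
Context {R : realType}.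
Implicit Types A B : cstarType R.

Definition star_hom A B (f : A -> B) : Prop :=
  [/\ linear f, monoid_morphism f & {morph f : x / star x >-> star x}].

Definition star_isomorphic A B : Prop :=
  exists2 f : A -> B, star_hom f & bijective f.

(* Not required to contain the unit of A. *)
Definition cstar_subalgebra A (S : set A) : Prop :=
  [/\ S 0,
      forall (a : R[i]) (x y : A), S x -> S y -> S (a *: x + y),
      forall x y : A, S x -> S y -> S (x * y),
      forall x : A, S x -> S (star x)
    & closed S].

Definition cstar_generated A (G : set A) : set A :=
  smallest (@cstar_subalgebra A) G.

Definition invertible A (x : A) : Prop := exists y, x * y = 1 /\ y * x = 1.

Definition cstar_spectrum A (x : A) : set R[i] :=
  [set z | ~ invertible (x - z%:A)].

(* In R[i], 0 <= z means that z is real and nonnegative. *)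
Definition positive A (x : A) : Prop :=
  star x = x /\ cstar_spectrum x `<=` [set z | 0 <= z].

(* Inductive limits of sequences, as completions of the algebraic limit for   *)
(* the limit seminorm.                                                        *)
Fixpoint iter_connecting (Z : nat -> cstarType R)
    (Phi : forall n, Z n -> Z n.+1) (n k : nat) : Z n -> Z (k + n)%N :=
  match k with
  | 0 => id
  | k'.+1 => fun x => Phi (k' + n)%N (iter_connecting Phi k' x)
  end.

Definition inductive_limit (Z : nat -> cstarType R)
    (Phi : forall n, Z n -> Z n.+1) A (phi : forall n, Z n -> A) : Prop :=
  [/\ forall n, star_hom (phi n),
      forall n (x : Z n), phi n.+1 (Phi n x) = phi n x,
      forall n (x : Z n),
        (fun k => `|iter_connecting Phi k x|) @ \oo --> `|phi n x|
    & closure (\bigcup_n range (phi n)) = setT].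

Definition closed_ideal A (J : set A) : Prop :=
  [/\ J 0,
      forall (a : R[i]) (x y : A), J x -> J y -> J (a *: x + y),
      forall x y : A, J y -> J (x * y) /\ J (y * x)
    & closed J].

Definition simple_cstar A : Prop :=
  forall J : set A, closed_ideal J -> J = [set 0] \/ J = setT.

Definition infinite_dimensional A : Prop :=
  ~ exists n (e : 'I_n -> A),
      forall x : A, exists a : 'I_n -> R[i], x = \sum_(i < n) a i *: e i.

Definition tracial_state A (tau : A -> R[i]) : Prop :=
  [/\ forall (a : R[i]) (x y : A), tau (a *: x + y) = a * tau x + tau y,
      forall x : A, 0 <= tau (star x * x),
      tau 1 = 1
    & forall x y : A, tau (x * y) = tau (y * x)].

Local Notation I := (set_type (`[0, 1] : set R)).

Definition adjmx (n : nat) (M : 'M[R[i]]_n) : 'M[R[i]]_n := map_mx Num.conj M^T.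

Definition dimension_drop (p q : nat) : set (I -> 'M[R[i]]_(p * q)) :=
  [set f : I -> 'M[R[i]]_(p * q) | [/\ continuous f,
     forall t : I, \val t = 0 ->
       exists a : 'M[R[i]]_p, f t = tensmx a (1%:M : 'M[R[i]]_q)
   & forall t : I, \val t = 1 ->
       exists b : 'M[R[i]]_q, f t = tensmx (1%:M : 'M[R[i]]_p) b]].

(* The C*-norm of the dimension drop algebra is determined by its *-algebra   *)
(* structure, so an isomorphism of *-algebras is all that is needed.          *)
Definition isomorphic_dimension_drop A (p q : nat) : Prop :=
  exists2 f : A -> I -> 'M[R[i]]_(p * q),
    [/\ forall (a : R[i]) (x y : A) t, f (a *: x + y) t = a *: f x t + f y t,
        forall (x y : A) t, f (x * y) t = f x t *m f y t
      & forall (x : A) t, f (star x) t = adjmx (f x t)]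
  & set_bij setT (@dimension_drop p q) f.

Definition jiang_su A : Prop :=
  [/\ simple_cstar A, infinite_dimensional A,
      exists! tau : A -> R[i], tracial_state tau
    & exists (B : nat -> cstarType R) (p q : nat -> nat)
             (Phi : forall n, B n -> B n.+1) (phi : forall n, B n -> A),
        [/\ forall n, [&& 0 < p n, 0 < q n & coprime (p n) (q n)]%N,
            forall n, isomorphic_dimension_drop (B n) (p n) (q n),
            forall n, star_hom (Phi n)
          & inductive_limit Phi phi]].

(* Generators are indexed from 1 to L; the other values of c are irrelevant.  *)
Definition Ztilde_relations A (L : nat) (c : nat -> A) (s : A) : Prop :=
  [/\ positive (c 1%N),
      forall i, (1 <= i <= L)%N -> c i * star (c i) = c 1%N ^+ 2,
      forall i j, (1 <= i <= L)%N -> (1 <= j <= L)%N -> i != j ->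
        (star (c i) * c i) * (star (c j) * c j) = 0,
      c 1%N * s = s
    & \sum_(1 <= l < L.+1) star (c l) * c l + star s * s = 1].

Definition is_Ztilde A (L : nat) (c : nat -> A) (s : A) : Prop :=
  Ztilde_relations L c s /\
  forall (B : cstarType R) (d : nat -> B) (t : B), Ztilde_relations L d t ->
    exists! f : A -> B,
      [/\ star_hom f, forall i, (1 <= i <= L)%N -> f (c i) = d i & f s = t].

Definition Dtilde A (L : nat) (c : nat -> A) (s : A) : set A :=
  cstar_generated
    ([set star (c i) * c i | i in [set i | (1 <= i <= L)%N]]
     `|` [set star s * s]
     `|` [set star (c i) * s * star s * c i | i in [set i | (1 <= i <= L)%N]]
     `|` [set x | exists i j, [/\ (1 <= i <= L)%N, (1 <= j <= L)%N
          & x = star (c j) * s * star (c i) * c i * star s * c j]]).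

(* C_0((0,1]) (x) M_n, as the M_n-valued continuous functions on [0,1]        *)
(* vanishing at 0.                                                            *)
Definition cone (n : nat) : set (I -> 'M[R[i]]_n) :=
  [set f : I -> 'M[R[i]]_n | continuous f /\ forall t : I, \val t = 0 -> f t = 0].

(* A map defined on all functions, of which only the values on the cone count.*)
Definition cone_star_hom (n : nat) A (Psi : (I -> 'M[R[i]]_n) -> A) : Prop :=
  [/\ forall (a : R[i]) f g, cone f -> cone g ->
        Psi (fun t => a *: f t + g t) = a *: Psi f + Psi g,
      forall f g, cone f -> cone g -> Psi (fun t => f t *m g t) = Psi f * Psi g
    & forall f, cone f -> Psi (fun t => adjmx (f t)) = star (Psi f)].

(* f (x) e_(i,j), where rows and columns are numbered from 1. *)
Definition elt_tensor (n : nat) (f : R -> R) (i j : nat) : I -> 'M[R[i]]_n :=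
  fun t => (f (\val t))%:C *:
    \matrix_(a < n, b < n) ((a.+1 == i) && (b.+1 == j))%:R.

Definition g_fun (t : R) : R := Num.min (4 * t) 1.
Definition h_fun (t : R) : R := Num.max 0 (4 * (t - 3 / 4)).

Definition next_L (L M K : nat) : nat := (K * M * L ^ 2 + M * L)%N.

Section Connecting.
Variables (A : cstarType R) (L M K : nat).
Local Notation K' := (K * M * L)%N.
Local Notation L' := (next_L L M K).
Variables (Psi : (I -> 'M[R[i]]_L') -> A) (Theta : (I -> 'M[R[i]]_2) -> A).

Definition c_tilde (l : nat) : A :=
  \sum_(1 <= i < K'.+1)
    Psi (elt_tensor L' (fun t => Num.sqrt (g_fun t))
           i (l.-1 * (K' + M) + i)%N)
  + \sum_(1 <= i < M.+1)
    Psi (elt_tensor L' (fun t => Num.sqrt (g_fun t - i%:R / M%:R * h_fun t))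
           (K' + i)%N (l * K' + l.-1 * M + i)%N).

Definition s_tilde : A :=
  Theta (elt_tensor 2 (fun t => Num.sqrt (h_fun t)) 1 2)
  + \sum_(1 <= l < L.+1) \sum_(1 <= i < M.+1)
    Psi (elt_tensor L' (fun t => Num.sqrt (i%:R / M%:R * h_fun t))
           (l.-1 * M + i + 1)%N (l * K' + l.-1 * M + i)%N).

End Connecting.

(* Phi is the homomorphism associated with (L, M, K), from the algebra        *)
(* generated by cbar, sbar to the one generated by c, s.                      *)
Definition connecting_hom A B (L M K : nat) (cbar : nat -> A) (sbar : A)
    (c : nat -> B) (s : B) (Phi : A -> B) : Prop :=
  exists (Psi : (I -> 'M[R[i]]_(next_L L M K)) -> B)
         (Theta : (I -> 'M[R[i]]_2) -> B),
    [/\ cone_star_hom Psi /\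
        (forall i, (1 <= i <= next_L L M K)%N ->
           Psi (elt_tensor _ Num.sqrt 1 i) = c i),
        cone_star_hom Theta /\ Theta (elt_tensor _ Num.sqrt 1 2) = s,
        star_hom Phi,
        forall l, (1 <= l <= L)%N -> Phi (cbar l) = c_tilde Psi l
      & Phi sbar = s_tilde Psi Theta].

(* The inductive limit of subalgebras D n of Z n, inside the limit of Z n. *)
Definition limit_subalgebra (Z : nat -> cstarType R) A
    (phi : forall n, Z n -> A) (D : forall n, set (Z n)) : set A :=
  closure (\bigcup_n (phi n @` D n)).

(* Nonzero algebra homomorphisms D -> R[i]. *)
Definition character A (D : set A) (chi : D -> R[i]) : Prop :=
  [/\ forall (a : R[i]) (x y z : D), \val z = a *: \val x + \val y ->
        chi z = a * chi x + chi y,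
      forall x y z : D, \val z = \val x * \val y -> chi z = chi x * chi y
    & exists x, chi x != 0].

Definition gelfand_spectrum A (D : set A) : topologicalType :=
  set_type [set chi : {ptws D -> R[i]} | character chi].

Arguments gelfand_spectrum [A] D.

End CStar.

Definition connected_nbhs_base (X : topologicalType) (x : X) : Prop :=
  exists2 B : set (set X),
    B `<=` [set V | nbhs x V /\ connected V]
  & forall U, nbhs x U -> exists2 V, B V & V `<=` U.

Definition not_locally_connected (X : topologicalType) : Prop :=
  exists x : X, ~ connected_nbhs_base x.

(* Main.v *)
(* The spectrum of the limit diagonal is an inverse limit of finite graphs.   *)
(* Let x be the character with x(s_n^* s_n) = 1 for all n.  At level n + 1    *)
(* let q be the last column of the first block, in which the connecting map   *)
(* uses the function g - h.  Since g - h vanishes at 1, the point             *)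
(* c_q^* c_q = 1 of level n + 1 lies over the point s_n^* s_n = 1 of level n, *)
(* so a character y_n above the former agrees with x on the diagonals of the  *)
(* levels up to n, and y_n tends to x.  A connected neighbourhood of x        *)
(* containing y_n contains a character taking the value 1/2 on c_q^* c_q at   *)
(* level n + 1.  Because g - h = 1 near 1/2 and g = 1 near 1, that character  *)
(* takes the value 1 on c_1^* c_1 at all levels up to n, in particular at the *)
(* first one, where x takes the value 0: it is not close to x.                *)
(*                                                                            *)
(* Characters are obtained by excision: if e_k <> 0 and every d satisfies     *)
(* d e_k ~ chi(d) e_k as k grows, then chi is a character.  The e_k are       *)
(* images h(c_q^* c_q) of the bump function h; they are nonzero, since        *)
(* otherwise s = h(c_1^* c_1) s = 0 and the c_j^* c_j are projections killed  *)
(* by h, hence 0, although they sum to 1.                                     *)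

Require Import Defs.
From HB Require Import structures.
From mathcomp Require Import all_boot all_order all_algebra.
From mathcomp Require Import all_classical all_reals all_analysis.
From mathcomp Require Import complex.
From mathcomp Require Import ring lra zify.

Set Implicit Arguments.
Unset Strict Implicit.
Unset Printing Implicit Defensive.

Import Order.TTheory GRing.Theory Num.Theory.
Import numFieldNormedType.Exports.

Local Open Scope classical_set_scope.
Local Open Scope complex_scope.
Local Open Scope ring_scope.

(** All levels are pushed into the one limit algebra, where each connecting map becomes a pair of
    equations expressing [c_l] and [s] of a level by cone elements of the next. Points of the
    spectrum are then produced and compared by left multiplication alone: an element [z] with
    [d z = x z] plays the role of a point at which [d] has the value [x].

    Existence. Following one column through the levels gives elements [thread n k], each absorbed on
    the left by the earlier ones of the same thread. By [thread_excise] and [thread_kill] every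
    generator of every diagonal acts on the late ones by a scalar. Approximate eigenvalues survive
    sums, products and norm limits, so [excision_character] turns a thread into a character [y n],
    and the diagonal sequence [base] into the character [x]. Since [base n] belongs to thread [n],
    [thread_base_dist] gives that [y n] tends to [x].

    Obstruction. [character_value_one] is functional calculus under an arbitrary character. Through
    [first_cc_of_last] and [first_cc_descend] it forces any character with real part 1/2 at the last
    column of level [n + 1] to be 1 on the first column at every level up to [n], whereas [x] is 0
    there. The intermediate value theorem supplies such a character in every connected neighbourhood
    of [x].

    The analytic tools, namely contractivity of homomorphisms and polynomial approximation in the
    cone, are derived from square roots of [1 - z] and from Bernstein polynomials, without spectral
    theory. *)

(** * The norm of a C*-algebra *)

Section CStarNorm.
Context {R : realType}.
Implicit Types A B : cstarType R.

(** The norm takes values in [R[i]]; its real part carries the same information and is accessible to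
    real ordered-field arithmetic. *)
Definition rnorm A (x : A) : R := complex.Re `|x|.

Lemma rnormE A (x : A) : `|x| = (rnorm x)%:C.
Proof.
by rewrite /rnorm; have := normr_ge0 x; case: `|x| => a b; rewrite lecE /= => /andP[/eqP -> _].
Qed.

Lemma rnorm_ge0 A (x : A) : 0 <= rnorm x.
Proof. by rewrite -lecR -rnormE; exact: normr_ge0. Qed.

Lemma rnorm_eq0 A (x : A) : rnorm x = 0 -> x = 0.
Proof. by move=> x0; apply/normr0_eq0; rewrite rnormE x0. Qed.

Lemma rnorm0 A : rnorm (0 : A) = 0.
Proof. by rewrite /rnorm normr0. Qed.

Lemma rnormN A (x : A) : rnorm (- x) = rnorm x.
Proof. by rewrite /rnorm normrN. Qed.

Lemma rnormD A (x y : A) : rnorm (x + y) <= rnorm x + rnorm y.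
Proof. by rewrite -lecR rmorphD /= -!rnormE ler_normD. Qed.

Lemma rnormB A (x y : A) : rnorm (x - y) = rnorm (y - x).
Proof. by rewrite -rnormN opprB. Qed.

Lemma rnorm_triangle A (x y z : A) : rnorm (x - z) <= rnorm (x - y) + rnorm (y - z).
Proof. by rewrite -[x - z](subrKA y); exact: rnormD. Qed.

Definition cabs (z : R[i]) : R := complex.Re `|z|.

Lemma cabsE (z : R[i]) : `|z| = (cabs z)%:C.
Proof. by case: z => a b; rewrite /cabs normc_def. Qed.

Lemma cabs_ge0 (z : R[i]) : 0 <= cabs z.
Proof. by rewrite -lecR -cabsE; exact: normr_ge0. Qed.

Lemma cabsR (r : R) : cabs r%:C = `|r|.
Proof. by rewrite /cabs normc_def /= expr0n /= addr0 sqrtr_sqr. Qed.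

Lemma cabs_eq0 (z : R[i]) : cabs z <= 0 -> z = 0.
Proof.
move=> z0; apply/eqP; rewrite -normr_eq0 cabsE; apply/eqP; congr (_%:C).
by apply/eqP; rewrite eq_le z0 cabs_ge0.
Qed.

Lemma cabs_Re (z : R[i]) : `|complex.Re z| <= cabs z.
Proof.
case: z => a b; rewrite /cabs normc_def /= -sqrtr_sqr ler_wsqrtr// lerDl sqr_ge0//.
Qed.

Lemma cabs_Im (z : R[i]) : `|complex.Im z| <= cabs z.
Proof.
case: z => a b; rewrite /cabs normc_def /= -sqrtr_sqr ler_wsqrtr// lerDr sqr_ge0//.
Qed.

Lemma cabs_le (z : R[i]) : cabs z <= `|complex.Re z| + `|complex.Im z|.
Proof.
case: z => a b; rewrite /cabs normc_def /= -[X in _ <= X]ger0_norm ?addr_ge0//.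
rewrite -sqrtr_sqr ler_wsqrtr// sqrrD !real_normK ?num_real//.
by rewrite -addrA [X in _ <= _ + X]addrC addrA lerDl mulrn_wge0// mulr_ge0.
Qed.

Lemma cabs_ReB (z w : R[i]) : `|complex.Re z - complex.Re w| <= cabs (z - w).
Proof.
have -> : complex.Re z - complex.Re w = complex.Re (z - w) by case: z w => [? ?] [].
exact: cabs_Re.
Qed.

Lemma rnormZ A (k : R[i]) (x : A) : rnorm (k *: x) = cabs k * rnorm x.
Proof.
by apply: (@complexI R); rewrite rmorphM /= -cabsE -!rnormE normrZ.
Qed.

Lemma rnormM A (x y : A) : rnorm (x * y) <= rnorm x * rnorm y.
Proof. by rewrite -lecR rmorphM /= -!rnormE cstar_ler_normM. Qed.

Lemma star_mul A (x y : A) : star (x * y) = star y * star x.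
Proof. exact: starM. Qed.

Lemma rnorm_star_mul A (x : A) : rnorm (star x * x) = rnorm x ^+ 2.
Proof. by apply: (@complexI R); rewrite rmorphXn /= -!rnormE cstar_norm. Qed.

Lemma gtc0_real (e : R[i]) : 0 < e -> exists2 r : R, 0 < r & e = r%:C.
Proof. by case: e => a b; rewrite ltcE /= => /andP[/eqP -> a0]; exists a. Qed.

Lemma star1 A : star (1 : A) = 1.
Proof. by have := star_mul (star (1 : A)) 1; rewrite mulr1 starK mulr1. Qed.

Lemma rnorm1 A : rnorm (1 : A) = 1.
Proof.
have := rnorm_star_mul (1 : A); rewrite star1 mulr1 expr2 => /eqP.
rewrite -subr_eq0 -{1}[rnorm 1]mulr1 -mulrBr mulf_eq0 => /orP[/eqP/rnorm_eq0|].
  by move/eqP; rewrite oner_eq0.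
by rewrite subr_eq0 => /eqP.
Qed.

Lemma closure_approx A (S : set A) x : closure S x ->
  forall e, 0 < e -> exists2 y, S y & rnorm (x - y) < e.
Proof.
move=> clx e e0; have [|y [Sy /= yx]] := clx [set y | rnorm (x - y) < e]; last by exists y.
apply/nbhs_normP; exists e%:C => /=; first by rewrite ltcR.
by move=> y /=; rewrite rnormE ltcR.
Qed.

Lemma closedP A (S : set A) :
  closed S <-> forall x, (forall e, 0 < e -> exists2 y, S y & rnorm (x - y) < e) -> S x.
Proof.
split=> [cS x xS|h].
  apply: cS => V /nbhs_normP[e /= e0 eV].
  have [r r0 er] := gtc0_real e0.
  have [y Sy xy] := xS _ r0; exists y; split => //; apply: eV => /=.
  by rewrite rnormE er ltcR.
by move=> x /closure_approx; exact: h.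
Qed.

Lemma rnorm_complete A (u : nat -> A) :
  (forall e, 0 < e -> exists N, forall m n, (N <= m)%N -> (N <= n)%N -> rnorm (u m - u n) < e) ->
  exists l, forall e, 0 < e -> exists N, forall n, (N <= n)%N -> rnorm (l - u n) < e.
Proof.
move=> cu; have : cvg (u @ \oo).
  apply/cauchy_cvgP/cauchy_ballP => e /gtc0_real[r r0 ->].
  have [N hN] := cu _ r0.
  pose V := u @` [set n | (N <= n)%N].
  exists (V, V); first by split; exists N => // n Nn; exists n.
  move=> [_ _] [/= [m Nm <-] [n Nn <-]]; rewrite -ball_normE /ball_ /=.
  by rewrite rnormE ltcR; exact: hN.
move=> /cvg_ex[l /cvgrPdist_lt ul]; exists l => e e0.
have [|N _ hN] := ul e%:C; first by rewrite ltcR.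
by exists N => n Nn; have := hN n Nn; rewrite /= rnormE ltcR.
Qed.

Lemma rnorm_star A (x : A) : rnorm (star x) = rnorm x.
Proof.
(* The C*-identity bounds the square of the norm of [y] by the norm of [star y] times that of
   [y]. *)
have h (y : A) : rnorm y <= rnorm (star y).
  have [y0|y0] := eqVneq (rnorm y) 0; first by rewrite y0 rnorm_ge0.
  rewrite -(ler_pM2r (_ : 0 < rnorm y)) ?lt_def ?y0 ?rnorm_ge0//.
  by rewrite -expr2 -rnorm_star_mul rnormM.
by apply/eqP; rewrite eq_le h -{2}[x]starK h.
Qed.

Lemma star_mul_eq0 A (x : A) : star x * x = 0 -> x = 0.
Proof.
move=> xx; apply: rnorm_eq0; apply/eqP.
by rewrite -sqrf_eq0 -rnorm_star_mul xx rnorm0.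
Qed.

Lemma star0 A : star (0 : A) = 0.
Proof. by rewrite -(scale0r (0 : A)) starZ rmorph0 !scale0r. Qed.

Lemma starN A (x : A) : star (- x) = - star x.
Proof. by rewrite -scaleN1r starZ rmorphN1 scaleN1r. Qed.

Lemma starB A (x y : A) : star (x - y) = star x - star y.
Proof. by rewrite starD starN. Qed.

Lemma star_sum A I (r : seq I) (P : pred I) (F : I -> A) :
  star (\sum_(i <- r | P i) F i) = \sum_(i <- r | P i) star (F i).
Proof. by apply: (big_morph _ (@starD _ _) (@star0 _)). Qed.

End CStarNorm.

(** * Unital *-homomorphisms are contractive *)

Section Contractive.
Context {R : realType}.
Implicit Types A B : cstarType R.

Lemma conj_real (r : R) : Num.conj r%:C = r%:C.
Proof. exact: conjc_real. Qed.

Lemma rnorm_small A (x : A) : (forall e, 0 < e -> rnorm x <= e) -> x = 0.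
Proof.
move=> h; apply: rnorm_eq0; apply/eqP; rewrite eq_le rnorm_ge0 andbT.
by apply/ler_addgt0Pr => e e0; rewrite add0r h.
Qed.

Lemma half_scaleK A (y : A) : (2^-1)%:C *: y + (2^-1)%:C *: y = y.
Proof.
rewrite -scalerDl -rmorphD /= (_ : 2^-1 + 2^-1 = 1 :> R) ?scale1r//; lra.
Qed.

Lemma imaginary_unit : exists2 k : R[i], k * k = -1 & Num.conj k = - k.
Proof. by exists 'i; [rewrite -expr2 sqr_i|apply/eqP; rewrite eq_complex /= oppr0 !eqxx]. Qed.

(* [a] is the real part of the unitary [a + i b]. *)
Lemma rnorm_unitary_part A (a b : A) : star a = a -> star b = b -> a * b = b * a ->
  a * a + b * b = 1 -> rnorm a <= 1.
Proof.
move=> sa sb ab ab1; have [k kk ck] := imaginary_unit.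
pose u := a + k *: b.
have su : star u = a - k *: b by rewrite starD starZ sa sb ck scaleNr.
have uu : star u * u = 1.
  rewrite su mulrDr !mulrDl !mulNr -!scalerAl -!scalerAr scalerA kk ab.
  by rewrite scaleN1r opprK addrA subrK.
have nu : rnorm u = 1.
  have := rnorm_star_mul u; rewrite uu rnorm1 => /esym/eqP.
  by rewrite sqrp_eq1 ?rnorm_ge0// => /eqP.
have -> : a = (2^-1)%:C *: (u + star u).
  by rewrite su addrACA subrr addr0 scalerDr half_scaleK.
rewrite rnormZ cabsR ger0_norm ?invr_ge0//.
have := rnormD u (star u); rewrite rnorm_star nu; lra.
Qed.

(* [b = 1 - w], where [w] is the limit of the iteration [w := (z + w^2) / 2]. *)
Lemma sqrt_one_minus A (z : A) : star z = z -> rnorm z < 1 ->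
  exists b : A, [/\ star b = b, b * b = 1 - z & forall y, y * z = z * y -> y * b = b * y].
Proof.
move=> sz z1; set r := rnorm z in z1.
have r0 : 0 <= r := rnorm_ge0 z.
pose w := fix w n := if n is m.+1 then (2^-1)%:C *: (z + w m * w m) else 0 : A.
have wS n : w n.+1 = (2^-1)%:C *: (z + w n * w n) by [].
have c2 : cabs ((2^-1)%:C : R[i]) = 2^-1 by rewrite cabsR ger0_norm ?invr_ge0.
have wr n : rnorm (w n) <= r.
  elim: n => [|n IH]; first by rewrite rnorm0.
  rewrite wS rnormZ c2.
  have := rnormD z (w n * w n); have := rnormM (w n) (w n).
  have := rnorm_ge0 (w n); rewrite -/r; nra.
(* The difference of two iterates is half a difference of squares of elements of norm at most [r],
   so each step contracts by the factor [r]. *)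
have wd n m : rnorm (w (n + m)%N - w n) <= r ^+ n.
  elim: n => [|n IH]; first by rewrite subr0 expr0 (le_trans (wr _))// ltW.
  rewrite addSn !wS -scalerBr rnormZ c2 opprD addrACA subrr add0r.
  set p := w (n + m)%N; set q := w n.
  have -> : p * p - q * q = p * (p - q) + (p - q) * q.
    by rewrite mulrBr mulrBl addrA subrK.
  have := rnormD (p * (p - q)) ((p - q) * q).
  have := rnormM p (p - q); have := rnormM (p - q) q.
  have := wr (n + m)%N; have := wr n; rewrite -/p -/q.
  have := rnorm_ge0 p; have := rnorm_ge0 q; have := rnorm_ge0 (p - q).
  rewrite exprS; move: IH; rewrite -/p -/q.
  move: (rnorm (p - q)) => d; move: (rnorm p) (rnorm q) => a b.
  move: (r ^+ n) => rn.
  move=> d_le d0 b0 a0 br ar h1 h2 h3.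
  have : a * d <= r * rn by apply: ler_pM.
  have : d * b <= rn * r by apply: ler_pM.
  move: h1 h2 h3; move: (rnorm _) (rnorm _) (rnorm _) (a * d) (d * b) => *; lra.
have [l wl] : exists l : A, forall e, 0 < e ->
    exists N, forall n, (N <= n)%N -> rnorm (l - w n) < e.
  apply: rnorm_complete => e e0.
  have : \forall n \near \oo, r ^+ n < e.
    have : (fun n => r ^+ n) @ \oo --> 0 by apply: cvg_expr; rewrite ger0_norm.
    move/cvgrPdist_lt => /(_ e e0); apply: filterS => n.
    by rewrite sub0r normrN ger0_norm ?exprn_ge0.
  case=> N _ hN; exists N.
  suff H m n : (N <= m)%N -> (m <= n)%N -> rnorm (w m - w n) < e.
    move=> m n Nm Nn; case/orP: (leq_total m n) => mn; first exact: H.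
    by rewrite rnormB H.
  move=> Nm mn; rewrite rnormB -(subnKC mn) (le_lt_trans (wd _ _))//; exact: hN.
have sw n : star (w n) = w n.
  elim: n => [|n IH]; first exact: star0.
  by rewrite wS starZ starD star_mul IH sz conj_real.
have cw y n : y * z = z * y -> y * w n = w n * y.
  move=> yz; elim: n => [|n IH]; first by rewrite mulr0 mul0r.
  by rewrite wS -scalerAl -scalerAr mulrDr mulrDl yz mulrA IH -mulrA IH mulrA.
(* Device for passing to the limit: whatever is bounded by a fixed multiple of the distances from
   [l] to two successive iterates vanishes. *)
have small (x : A) (C : R) : 0 <= C ->
    (forall n, rnorm x <= C * rnorm (l - w n) + C * rnorm (l - w n.+1)) -> x = 0.
  move=> C0 h; apply: rnorm_small => e e0.
  have C1 : 0 < 2 * (C + 1) by lra.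
  have [N hN] := wl _ (divr_gt0 e0 C1).
  apply: le_trans (h N) _; have := hN N (leqnn N); have := hN N.+1 (leqnSn N).
  rewrite !ltr_pdivlMr//; have := rnorm_ge0 (l - w N); have := rnorm_ge0 (l - w N.+1).
  move: (rnorm _) (rnorm _) => a b; nra.
have sl : star l = l.
  apply/eqP; rewrite -subr_eq0; apply/eqP; apply: (small _ 2) => // n.
  rewrite (_ : star l - l = star (l - w n) - (l - w n)); last first.
    by rewrite starB sw opprB addrA subrK.
  have := rnormD (star (l - w n)) (- (l - w n)); rewrite rnorm_star rnormN.
  have := rnorm_ge0 (l - w n.+1); lra.
have cl y : y * z = z * y -> y * l = l * y.
  move=> yz; apply/eqP; rewrite -subr_eq0; apply/eqP; apply: (small _ (2 * rnorm y)).
    by rewrite mulr_ge0 ?rnorm_ge0.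
  move=> n; rewrite (_ : y * l - l * y = y * (l - w n) - (l - w n) * y); last first.
    by rewrite mulrBr mulrBl (cw y n yz) opprB addrA subrK.
  have := rnormD (y * (l - w n)) (- ((l - w n) * y)); rewrite rnormN.
  have := rnormM y (l - w n); have := rnormM (l - w n) y.
  have := rnorm_ge0 (l - w n.+1); have := rnorm_ge0 y; nra.
(* The fixed point equation, equivalent to [(1 - l)^2 = 1 - z]. *)
have ll : l + l = z + l * l.
  rewrite -[RHS]half_scaleK; suff <- : l = (2^-1)%:C *: (z + l * l) by [].
  apply/eqP; rewrite -subr_eq0; apply/eqP; apply: (small _ (1 + rnorm l + r)).
    by have := rnorm_ge0 l; lra.
  move=> n; rewrite -(subrKA (w n.+1)) wS -scalerBr opprD addrACA subrr add0r -wS.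
  apply: le_trans (rnormD _ _) _; rewrite rnormZ c2.
  have -> : w n * w n - l * l = w n * (w n - l) + (w n - l) * l.
    by rewrite mulrBr mulrBl addrA subrK.
  have := rnormD (w n * (w n - l)) ((w n - l) * l).
  have := rnormM (w n) (w n - l); have := rnormM (w n - l) l.
  have := wr n; rewrite (rnormB (w n) l); have := rnorm_ge0 (w n); have := rnorm_ge0 l.
  have := rnorm_ge0 (l - w n); have := rnorm_ge0 (l - w n.+1).
  move: (rnorm (l - w n)) (rnorm (l - w n.+1)) => a b; nra.
exists (1 - l); split; first by rewrite starB star1 sl.
  rewrite mulrBr mulr1 mulrBl mul1r opprB -addrA; congr (1 + _).
  by rewrite addrC -addrA -opprD ll opprD addrC addrNK.
by move=> y yz; rewrite mulrBr mulrBl mulr1 mul1r cl.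
Qed.

Lemma star_hom0 A B (f : A -> B) : star_hom f -> f 0 = 0.
Proof. by case=> flin _ _; have := flin (-1) 0 0; rewrite scaler0 add0r scaleN1r addNr. Qed.

Lemma star_homD A B (f : A -> B) : star_hom f -> {morph f : x y / x + y}.
Proof. by case=> flin _ _ x y; have := flin 1 x y; rewrite !scale1r. Qed.

Lemma star_homZ A B (f : A -> B) (k : R[i]) : star_hom f -> {morph f : x / k *: x}.
Proof. by move=> hf x; have [flin _ _] := hf; rewrite -[k *: x]addr0 flin (star_hom0 hf) addr0. Qed.

Lemma star_homB A B (f : A -> B) : star_hom f -> {morph f : x y / x - y}.
Proof. by move=> hf x y; rewrite -[- y]scaleN1r (star_homD hf) (star_homZ _ hf) scaleN1r. Qed.

(** For self-adjoint [y] of norm below 1 let [b] be the square root of [1 - y^2]. Then [f y + i f b]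
    is unitary, so its real part [f y] has norm at most 1. Scaling and the C*-identity give the
    general case. *)
Lemma star_hom_contractive A B (f : A -> B) (x : A) : star_hom f -> rnorm (f x) <= rnorm x.
Proof.
move=> hf; have [_ [f1 fM] fstar] := hf.
have sa1 y : star y = y -> rnorm y < 1 -> rnorm (f y) <= 1.
  move=> sy y1.
  have [||b [sb bb cb]] := @sqrt_one_minus _ (y * y).
  - by rewrite star_mul sy.
  - have := rnormM y y; have := rnorm_ge0 y; nra.
  have yb : y * b = b * y by apply: cb; rewrite mulrA.
  apply: (@rnorm_unitary_part _ (f y) (f b)); rewrite -?fstar ?sy ?sb//.
    by rewrite -!fM yb.
  by rewrite -!fM bb -(star_homD hf) addrC subrK f1.
have sa y : star y = y -> rnorm (f y) <= rnorm y.
  move=> sy; apply/ler_addgt0Pr => e e0.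
  (* Dividing by [rnorm y + e] makes the norm strictly less than 1 and covers [y = 0]. *)
  have r0 : 0 < rnorm y + e by have := rnorm_ge0 y; lra.
  have ri0 := ltW r0.
  have := sa1 ((rnorm y + e)^-1%:C *: y).
  rewrite starZ conj_real sy (star_homZ _ hf) !rnormZ cabsR ger0_norm ?invr_ge0//.
  rewrite mulrC ltr_pdivrMr// mul1r ltrDl mulrC ler_pdivrMr// mul1r.
  exact.
rewrite -(@ler_pXn2r _ 2) ?nnegrE ?rnorm_ge0// -!rnorm_star_mul -fstar -fM.
by apply: sa; rewrite star_mul starK.
Qed.

End Contractive.

(** * Bernstein polynomials *)

Section Weierstrass.
Context {R : realType}.
Implicit Types (f : R -> R) (t : R).

(** Close to the diagonal uniform continuity suffices; away from it the quadratic term dominates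
    twice the maximum of the modulus of [f]. A quadratic error is what the second Bernstein moment
    evaluates. *)
Lemma continuous_quadratic_modulus f (e : R) : continuous f -> 0 < e ->
  exists C : R, 0 <= C /\ forall x y, 0 <= x <= 1 -> 0 <= y <= 1 ->
    `|f x - f y| <= e + C * (x - y) ^+ 2.
Proof.
move=> cf e0; have [M M0 fM] : exists2 M, 0 <= M & forall x, 0 <= x <= 1 -> `|f x| <= M.
  have [|c _ hc] := @EVT_max R (fun x => `|f x|) 0 1 ler01.
    by apply: continuous_subspaceT => x; exact/continuous_comp/norm_continuous/cf.
  by exists `|f c| => // x x01; apply: hc; rewrite in_itv.
have /compact_near_coveringP cov := @segment_compact R 0 1.
have := cov nat \oo (fun n x => forall y, 0 <= y <= 1 -> 0 <= x <= 1 ->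
  `|f x - f y| <= e + n%:R * (x - y) ^+ 2) _.
case=> [x _|n _ hn]; last first.
  exists n%:R; split=> // x y x01 y01.
  by apply: (hn n) => //=; rewrite in_itv.
have e2 : 0 < e / 2 by lra.
have /cvgrPdist_lt/(_ _ e2)/nbhs_normP[d /= d0 hd] := cf x.
(* When [x'] and [y] are at least [d / 2] apart, this choice of [n] gives
   [n (x' - y)^2 >= n d^2 / 4 >= 2 M]. *)
exists (ball x (d / 2), [set n | 2 * M * 4 / d ^+ 2 <= n%:R]).
  split; first by apply: nbhsx_ballx; lra.
  exact: nbhs_infty_ger.
move=> [x' n] [/=]; rewrite /ball /= => x'd nM y y01 x01.
have [yd|yd] := ltP `|x' - y| (d / 2).
  have : `|f x - f x'| < e / 2 by apply: hd => /=; lra.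
  have : `|f x - f y| < e / 2.
    apply: hd => /=; have := ler_normD (x - x') (x' - y); rewrite subrKA; lra.
  have : 0 <= n%:R * (x' - y) ^+ 2 by rewrite mulr_ge0// sqr_ge0.
  have := ler_normD (f x' - f x) (f x - f y); rewrite subrKA (distrC (f x') (f x)); lra.
have dd : d ^+ 2 / 4 <= (x' - y) ^+ 2.
  by rewrite -[X in _ <= X]real_normK ?num_real//; nra.
have : 2 * M <= n%:R * (x' - y) ^+ 2.
  have d20 : 0 < d ^+ 2 by rewrite exprn_gt0.
  apply: le_trans (_ : n%:R * (d ^+ 2 / 4) <= _); last by rewrite ler_wpM2l.
  by move: nM; rewrite ler_pdivrMr//; lra.
have := ler_normB (f x') (f y); have := fM _ x01; have := fM _ y01; lra.
Qed.

(* The combination of the Bernstein basis polynomials of degree [n] with      *)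
(* coefficients [u k], by de Casteljau's recursion.                           *)
Fixpoint bernstein (n : nat) (u : nat -> R) : {poly R} :=
  if n is m.+1 then 'X * bernstein m (fun k => u k.+1) + (1 - 'X) * bernstein m u
  else (u 0%N)%:P.

Lemma bernsteinS n u t : (bernstein n.+1 u).[t] =
  t * (bernstein n (fun k => u k.+1)).[t] + (1 - t) * (bernstein n u).[t].
Proof. by rewrite /= !hornerE. Qed.

Lemma bernstein_at0 n u : (bernstein n u).[0] = u 0%N.
Proof. by elim: n u => [|n IH] u; rewrite ?bernsteinS ?IH /= ?hornerC//; lra. Qed.

Lemma bernstein_lin n u v (a b t : R) :
  (bernstein n (fun k => a * u k + b * v k)).[t] =
  a * (bernstein n u).[t] + b * (bernstein n v).[t].
Proof.
elim: n u v => [|n IH] u v; first by rewrite /= !hornerC.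
by rewrite !bernsteinS !IH; lra.
Qed.

Lemma bernstein_const n (a t : R) : (bernstein n (fun=> a)).[t] = a.
Proof. by elim: n => [|n IH]; rewrite ?bernsteinS ?IH /= ?hornerC//; lra. Qed.

Lemma bernstein_le n u v t : 0 <= t <= 1 -> (forall k, (k <= n)%N -> u k <= v k) ->
  (bernstein n u).[t] <= (bernstein n v).[t].
Proof.
move=> t01; elim: n u v => [|n IH] u v uv; first by rewrite /= !hornerC uv.
rewrite !bernsteinS.
have h1 := IH (fun k => u k.+1) (fun k => v k.+1) (fun k kn => uv k.+1 kn).
have h2 := IH u v (fun k kn => uv k (leqW kn)).
by case/andP: t01 => t0 t1; apply: lerD; apply: ler_wpM2l => //; lra.
Qed.

(** Binomial variance plus squared bias. The centre [c] is left free so that the index shift in the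
    recursion becomes a shift of [c] in the induction. *)
Lemma bernstein_moment2 n (c t : R) :
  (bernstein n (fun k => (k%:R - c) ^+ 2)).[t] = n%:R * t * (1 - t) + (n%:R * t - c) ^+ 2.
Proof.
elim: n c => [|n IH] c; first by rewrite /= hornerC; lra.
rewrite bernsteinS IH.
have -> : (fun k => (k.+1%:R - c) ^+ 2) = (fun k => (k%:R - (c - 1)) ^+ 2) :> (nat -> R).
  by apply/funext => k; rewrite -natr1; congr (_ ^+ 2); lra.
by rewrite IH -natr1; ring.
Qed.

(** The Bernstein operator is linear, monotone and fixes constants, so it may be applied to the
    quadratic bound; centred at [N t], only the variance term [C t (1 - t) / N] remains. Exact
    agreement at 0 later allows a factor ['X] to be split off. *)
Lemma weierstrass f (e : R) : continuous f -> 0 < e ->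
  exists2 p : {poly R}, p.[0] = f 0 & forall t, 0 <= t <= 1 -> `|f t - p.[t]| <= e.
Proof.
move=> cf e0; have e2 : 0 < e / 2 by lra.
have [C [C0 hC]] := continuous_quadratic_modulus cf e2.
have [n hn] : exists n : nat, C / (e / 2) < n.+1%:R.
  exists (Num.truncn (C / (e / 2))); exact: Num.Theory.truncnS_gt.
set N := n.+1 in hn; have N0 : 0 < N%:R :> R by [].
exists (bernstein N (fun k => f (k%:R / N%:R))) => [|t t01].
  by rewrite bernstein_at0 mul0r.
have bound : C * (N%:R * t * (1 - t)) / N%:R ^+ 2 <= e / 2.
  rewrite ltr_pdivrMr// in hn.
  rewrite ler_pdivrMr ?exprn_gt0// expr2.
  case/andP: t01 => t0 t1.
  have : t * (1 - t) <= 1 by nra.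
  have tt : 0 <= t * (1 - t) by rewrite mulr_ge0//; lra.
  move: hn; move: (N%:R) N0 => r r0; rewrite -(mulrA r); move: (t * (1 - t)) tt => s s0 hr s1.
  have : C * s <= C by nra.
  have : 0 <= C * s by nra.
  nra.
(* The sign [s] treats both one-sided estimates at once. *)
have key (s : R) : s ^+ 2 = 1 -> s * f t - s * (bernstein N (fun k => f (k%:R / N%:R))).[t] <= e.
  move=> s2; have sle : forall k, (k <= N)%N -> (s * f t) - s * f (k%:R / N%:R) <=
      e / 2 + C / N%:R ^+ 2 * (k%:R - N%:R * t) ^+ 2.
    move=> k kN; rewrite -mulrBr.
    have kN01 : 0 <= (k%:R / N%:R : R) <= 1.
      by rewrite divr_ge0//= ler_pdivrMr// mul1r ler_nat.
    have -> : C / N%:R ^+ 2 * (k%:R - N%:R * t) ^+ 2 = C * (t - k%:R / N%:R) ^+ 2.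
      by field; rewrite lt0r_neq0.
    apply: le_trans (hC _ _ t01 kN01); apply: le_trans (ler_norm _) _.
    rewrite normrM (_ : `|s| = 1) ?mul1r//; apply/eqP.
    by rewrite -sqrp_eq1// real_normK ?num_real// s2.
  have := bernstein_le t01 sle.
  rewrite (_ : (fun k => e / 2 + C / N%:R ^+ 2 * (k%:R - N%:R * t) ^+ 2) =
    (fun k => 1 * (e / 2) + C / N%:R ^+ 2 * (k%:R - N%:R * t) ^+ 2)); last first.
    by apply/funext => k; rewrite mul1r.
  rewrite (_ : (fun k => s * f t - s * f (k%:R / N%:R)) =
    (fun k => 1 * (s * f t) + (- s) * f (k%:R / N%:R))); last first.
    by apply/funext => k; rewrite mul1r mulNr.
  rewrite !bernstein_lin !bernstein_const bernstein_moment2 subrr expr0n /= addr0.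
  rewrite mulrAC in bound; lra.
have := key 1; have := key (-1); rewrite sqrrN expr1n => /(_ erefl) h1 /(_ erefl) h2.
by rewrite ler_norml; apply/andP; split; lra.
Qed.

End Weierstrass.

(** * Homomorphisms on the cone over a matrix algebra *)

Section Cone.
Context {R : realType}.
Local Notation I := (set_type (`[0, 1] : set R)).
Implicit Types (f g : R -> R) (n i j k l : nat).

Lemma unit_itvP (t : I) : 0 <= \val t <= 1.
Proof. by have := set_valP t; rewrite /= in_itv. Qed.

Lemma continuous_realmul f (b : R[i]) (t : I) : continuous f ->
  (fun t : I => (f (\val t))%:C * b) @ t --> (f (\val t))%:C * b.
Proof.
move=> cf; apply/(@cvgrPdist_lt _ R[i]^o _ _ (nbhs_filter t)) => e /gtc0_real[r r0 ->].
have b0 : 0 < cabs b + 1 by rewrite ltr_wpDl// cabs_ge0.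
have ct : (fun t : I => f (\val t)) @ t --> f (\val t).
  apply: (@continuous_comp I R R \val f t); last exact: cf.
  exact: (@initial_continuous I R \val).
have := @cvgr_dist_lt _ R^o _ _ (nbhs_filter t) _ _ ct _ (divr_gt0 r0 b0).
apply: filterS => t' /=; rewrite ltr_pdivlMr// => h.
rewrite -mulrBl -rmorphB normrM /= !cabsE cabsR -rmorphM ltcR (le_lt_trans _ h)//.
by rewrite ler_wpM2l// lerDl.
Qed.

Lemma cone_elt_tensor n f i j : continuous f -> f 0 = 0 -> cone (elt_tensor n f i j).
Proof.
move=> cf f0; split=> [|t t0]; last by rewrite /elt_tensor t0 f0 scale0r.
move=> t B [P HP PB].
suff : \forall t' \near t, forall a b, P a b (elt_tensor n f i j t' a b).
  by apply: filterS => t' ht'; exact: PB.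
have FF := nbhs_filter t.
apply: (@filter_forall _ _ (fun a t' => forall b, P a b (elt_tensor n f i j t' a b)) _ FF) => a.
apply: (@filter_forall _ _ (fun b t' => P a b (elt_tensor n f i j t' a b)) _ FF) => b.
have := HP a b; rewrite !mxE => /(continuous_realmul cf).
by apply: (@filterS _ _ FF) => t' /=; rewrite !mxE.
Qed.

(* Functions on the line stand for their restrictions to [0, 1]. *)
Definition C0 f := continuous f /\ f 0 = 0.

Lemma C0_lin a f g : C0 f -> C0 g -> C0 (fun t => a * f t + g t).
Proof.
move=> [cf f0] [cg g0]; split=> [t|]; last by rewrite f0 g0 mulr0 addr0.
apply: cvgD; last exact: cg.
by apply: cvgM; [exact: cvg_cst|exact: cf].
Qed.

Lemma C0M f g : C0 f -> continuous g -> C0 (fun t => f t * g t).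
Proof.
move=> [cf f0] cg; split=> [t|]; last by rewrite f0 mul0r.
by apply: cvgM; [exact: cf|exact: cg].
Qed.

Lemma C0_id : C0 id.
Proof. by split=> // t; exact: cvg_id. Qed.

Lemma C0_ext f g : f =1 g -> C0 f -> C0 g.
Proof. by move=> /funext->. Qed.

Lemma elt_tensor_ext n f g i j : (forall t, 0 <= t <= 1 -> f t = g t) ->
  elt_tensor n f i j = elt_tensor n g i j.
Proof. by move=> fg; apply/funext => t; rewrite /elt_tensor fg// unit_itvP. Qed.

(** Matrix units with an index outside [1..n] are zero, hence the range condition on the middle
    index. *)
Lemma elt_tensor_mul n f g i j k l t : (1 <= j <= n)%N ->
  elt_tensor n f i j t *m elt_tensor n g k l t =
  if j == k then elt_tensor n (fun t => f t * g t) i l t else 0.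
Proof.
move=> /andP[j0 jn]; rewrite /elt_tensor -scalemxAl -scalemxAr scalerA -rmorphM /=.
have jn' : (j.-1 < n)%N by rewrite prednK.
case: eqP => [<-|jk].
  congr (_ *: _); apply/matrixP => a b; rewrite !mxE (bigD1 (Ordinal jn'))//= !mxE /=.
  rewrite prednK// eqxx andbT big1 ?addr0 => [|c cj].
    by rewrite -natrM mulnb.
  rewrite !mxE; case: (altP (c.+1 =P j)) => [cj'|]; last by rewrite andbF mul0r.
  by case/eqP: cj; apply: val_inj; rewrite /= -cj'.
apply/matrixP => a b; rewrite !mxE big1 ?mulr0// => c _; rewrite !mxE.
case: (altP (c.+1 =P j)) => [->|]; last by rewrite andbF mul0r.
by rewrite (_ : (j == k) = false) ?mulr0//; exact/eqP.
Qed.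

Lemma elt_tensor_adj n f i j t : adjmx (elt_tensor n f i j t) = elt_tensor n f j i t.
Proof.
apply/matrixP => a b; rewrite !mxE rmorphM /= conj_real; congr (_ * _).
by rewrite andbC rmorph_nat.
Qed.

End Cone.

Section ConeHom.
Context {R : realType} (A : cstarType R) (n : nat).
Local Notation I := (set_type (`[0, 1] : set R)).
Variable Psi : (I -> 'M[R[i]]_n) -> A.
Hypothesis hPsi : cone_star_hom Psi.
Implicit Types (f g : R -> R) (i j k l q : nat) (z : A).
Local Notation E f i j := (Psi (elt_tensor n f i j)).

Lemma C0_cone f i j : C0 f -> cone (elt_tensor n f i j).
Proof. by case; exact: cone_elt_tensor. Qed.

Lemma cone_homDZ a f g i j : C0 f -> C0 g ->
  E (fun t => a * f t + g t) i j = a%:C *: E f i j + E g i j.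
Proof.
move=> f0 g0; case: hPsi => hl _ _; rewrite -hl; try exact: C0_cone.
congr Psi; apply/funext => t; rewrite /elt_tensor rmorphD rmorphM /=.
by rewrite scalerDl scalerA.
Qed.

Lemma cone_hom0 i j : E (fun=> 0) i j = 0.
Proof.
have c0 : C0 (fun=> 0 : R) by split=> //; exact: cst_continuous.
have := cone_homDZ (-1) i j c0 c0.
rewrite (_ : (fun=> _) = (fun=> 0)) ?rmorphN1 ?scaleN1r ?addNr//.
by apply/funext => t; rewrite mulr0 addr0.
Qed.

Lemma cone_homB f g i j : C0 f -> C0 g -> E (fun t => f t - g t) i j = E f i j - E g i j.
Proof.
move=> f0 g0; have := cone_homDZ (-1) i j g0 f0; rewrite rmorphN1 scaleN1r addrC => <-.
by congr Psi; apply: elt_tensor_ext => t _; rewrite mulN1r addrC.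
Qed.

Lemma cone_hom_mul f g i j l : (1 <= j <= n)%N -> C0 f -> C0 g ->
  E f i j * E g j l = E (fun t => f t * g t) i l.
Proof.
move=> jn f0 g0; case: hPsi => _ hm _; rewrite -hm; try exact: C0_cone.
by congr Psi; apply/funext => t; rewrite elt_tensor_mul// eqxx.
Qed.

Lemma cone_hom_mul0 f g i j k l : (1 <= j <= n)%N -> j != k -> C0 f -> C0 g ->
  E f i j * E g k l = 0.
Proof.
move=> jn jk f0 g0; case: hPsi => _ hm _; rewrite -hm; try exact: C0_cone.
rewrite -(cone_hom0 i l); congr Psi; apply/funext => t.
by rewrite elt_tensor_mul// (negbTE jk) /elt_tensor scale0r.
Qed.

Lemma cone_hom_star f i j : C0 f -> star (E f i j) = E f j i.
Proof.
move=> f0; case: hPsi => _ _ hs; rewrite -hs; last exact: C0_cone.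
by congr Psi; apply/funext => t; rewrite elt_tensor_adj.
Qed.

(** The square root is 1 at 0, so it lies in the unitization of the cone; subtracting 1 brings it
    back into the cone. *)
Lemma C0_sqrt_one_minus f : C0 f -> C0 (fun t => Num.sqrt (1 - f t * f t) - 1).
Proof.
move=> [cf f0]; split=> [t|]; last by rewrite f0 mulr0 subr0 sqrtr1 subrr.
apply: cvgB; last exact: cvg_cst.
apply: continuous_comp; last exact: sqrt_continuous.
apply: cvgB; first exact: cvg_cst.
by apply: cvgM; exact: cf.
Qed.

(* For [f] bounded by 1, [f + i sqrt (1 - f^2)] is unitary in the unitization. *)
Lemma cone_hom_norm_le f q (C : R) : (1 <= q <= n)%N -> C0 f ->
  (forall t, 0 <= t <= 1 -> `|f t| <= C) -> rnorm (E f q q) <= C.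
Proof.
move=> qn f0 fC; apply/ler_addgt0Pr => e e0.
have C_ge0 : 0 <= C by apply: le_trans (fC 0 _); rewrite ?lexx ?ler01.
have c0 : 0 < C + e by lra.
pose h t := (C + e)^-1 * f t + 0.
have z0 : C0 (fun=> 0 : R) by split=> //; exact: cst_continuous.
have h0 : C0 h by apply: C0_lin.
have k0 := C0_sqrt_one_minus h0.
set k := (fun t => _) in k0.
have hc t : 0 <= t <= 1 -> h t * h t <= 1.
  move=> /fC ft; rewrite /h addr0 -expr2 -real_normK ?num_real// -[X in _ <= X](expr1n _ 2).
  rewrite ler_pXn2r ?nnegrE// normrM ger0_norm ?invr_ge0 ?(ltW c0)//.
  by rewrite mulrC ler_pdivrMr//; lra.
have : rnorm (E h q q) <= 1.
  apply: (@rnorm_unitary_part _ _ _ (1 + E k q q)).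
  - by rewrite cone_hom_star.
  - by rewrite starD star1 cone_hom_star.
  - rewrite mulrDr mulrDl mulr1 mul1r !cone_hom_mul//; congr (_ + _).
    by congr Psi; apply: elt_tensor_ext => t _; rewrite mulrC.
  have -> : (1 + E k q q) * (1 + E k q q) = 1 + (2%:C *: E k q q + E k q q * E k q q).
    rewrite mulrDl !mulrDr !mul1r mulr1 -!addrA; congr (_ + _); rewrite addrA; congr (_ + _).
    by rewrite -[X in X + _]scale1r -[X in _ + X]scale1r -scalerDl -(rmorphD (@real_complex R)).
  rewrite !cone_hom_mul// addrC -addrA -[RHS]addr0; congr (_ + _).
  have hh := C0M h0 h0.1; have kk := C0M k0 k0.1.
  rewrite -cone_homDZ//; set m := (fun t => _ + _).
  have m0 : C0 m by apply: C0_lin.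
  rewrite addrC -[E (fun t => h t * h t) q q]scale1r -(cone_homDZ 1)//.
  rewrite -(cone_hom0 q q); congr Psi; apply: elt_tensor_ext => t t01.
  rewrite mul1r /m /k; have := sqr_sqrtr (_ : 0 <= 1 - h t * h t).
  by rewrite subr_ge0 expr2 => /(_ (hc _ t01)) s2; nra.
rewrite cone_homDZ// cone_hom0 addr0 rnormZ cabsR ger0_norm ?invr_ge0 ?(ltW c0)//.
by rewrite mulrC ler_pdivrMr// mul1r.
Qed.

Lemma C0_poly (p : {poly R}) : C0 (fun t => p.[t] * t).
Proof.
split=> [t|]; last by rewrite mulr0.
by apply: cvgM; [exact: continuous_horner|exact: cvg_id].
Qed.

Lemma cone_hom_poly_cons (p : {poly R}) c q : (1 <= q <= n)%N ->
  E (fun t => (p * 'X + c%:P).[t] * t) q q =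
  c%:C *: E id q q + E (fun t => p.[t] * t) q q * E id q q.
Proof.
move=> qn; have p0 := C0_poly p; have id0 := @C0_id R.
have c2 : C0 (fun t => p.[t] * t * t) by exact: (C0M p0 id0.1).
rewrite cone_hom_mul// -cone_homDZ//; congr Psi.
by apply: elt_tensor_ext => t _; rewrite !hornerE; lra.
Qed.

Lemma cone_hom_poly0 q : E (fun t => (0 : {poly R}).[t] * t) q q = 0.
Proof.
by rewrite -(cone_hom0 q q); congr Psi; apply: elt_tensor_ext => t _; rewrite horner0 mul0r.
Qed.

Lemma cone_hom_poly_mem (S : set A) (p : {poly R}) q : (1 <= q <= n)%N -> cstar_subalgebra S ->
  S (E id q q) -> S (E (fun t => p.[t] * t) q q).
Proof.
move=> qn [S0 Sl Sm _ _] S1; elim/poly_ind: p => [|p c IH]; first by rewrite cone_hom_poly0.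
by rewrite cone_hom_poly_cons//; apply: Sl => //; exact: Sm.
Qed.

Lemma cone_hom_poly_eigen (p : {poly R}) q z (x : R) : (1 <= q <= n)%N ->
  E id q q * z = x%:C *: z -> E (fun t => p.[t] * t) q q * z = (p.[x] * x)%:C *: z.
Proof.
move=> qn xz; elim/poly_ind: p => [|p c IH].
  by rewrite cone_hom_poly0 horner0 !mul0r scale0r.
rewrite cone_hom_poly_cons// mulrDl -scalerAl xz -mulrA xz -scalerAr IH !scalerA -scalerDl.
by congr (_ *: _); rewrite !hornerE !(rmorphM, rmorphD) /=; ring.
Qed.

(** The Bernstein polynomial vanishes at 0 together with [f], hence is divisible by ['X]. *)
Lemma C0_approx f (e : R) : C0 f -> 0 < e ->
  exists p : {poly R}, forall t, 0 <= t <= 1 -> `|f t - p.[t] * t| <= e.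
Proof.
move=> [cf f0] e0; have [p p0 pf] := weierstrass cf e0.
have /factor_theorem[r pr] : root p 0 by apply/rootP; rewrite p0 f0.
by exists r => t /pf; rewrite pr !hornerE subr0.
Qed.

Lemma cone_hom_dist_le f g q (e : R) : (1 <= q <= n)%N -> C0 f -> C0 g ->
  (forall t, 0 <= t <= 1 -> `|f t - g t| <= e) -> rnorm (E f q q - E g q q) <= e.
Proof.
move=> qn f0 g0 fg; rewrite -cone_homB//; apply: cone_hom_norm_le => //.
by have := C0_lin (-1) g0 f0; apply: C0_ext => t; rewrite mulN1r addrC.
Qed.

Lemma cone_hom_mem (S : set A) f q : (1 <= q <= n)%N -> cstar_subalgebra S ->
  S (E id q q) -> C0 f -> S (E f q q).
Proof.
move=> qn hS S1 f0; have [_ _ _ _ /closedP Sc] := hS; apply: Sc => e e0.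
have [p pf] := C0_approx f0 (divr_gt0 e0 (ltr0n _ 2)).
exists (E (fun t => p.[t] * t) q q); first exact: cone_hom_poly_mem.
by have := cone_hom_dist_le qn f0 (C0_poly p) pf; lra.
Qed.

(** Spectral mapping: clear for polynomials without constant term, and both sides are continuous in
    [f] for the sup norm. *)
Lemma cone_hom_eigen f q z (x : R) : (1 <= q <= n)%N -> 0 <= x <= 1 -> C0 f ->
  E id q q * z = x%:C *: z -> E f q q * z = (f x)%:C *: z.
Proof.
move=> qn x01 f0 xz; apply/eqP; rewrite -subr_eq0; apply/eqP; apply: rnorm_small => e e0.
have z0 := rnorm_ge0 z; have z1 : 0 < 2 * (rnorm z + 1) by lra.
have [p pf] := C0_approx f0 (divr_gt0 e0 z1).
have ha := cone_hom_dist_le qn f0 (C0_poly p) pf; have hb := pf _ x01.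
rewrite -(subrKA ((p.[x] * x)%:C *: z)) -(cone_hom_poly_eigen p qn xz) -mulrBl.
rewrite (cone_hom_poly_eigen p qn xz) -scalerBl -rmorphB /=.
move: ha hb; set a := _ - E _ _ _; set b := p.[x] * x => ha hb.
apply: le_trans (rnormD _ _) _; rewrite rnormZ cabsR distrC.
apply: le_trans (lerD (rnormM _ _) (lexx _)) _.
rewrite -mulrDl.
move: ha hb; rewrite !ler_pdivlMr//; have := rnorm_ge0 a; have := normr_ge0 (f x - b).
move: (rnorm a) (`|f x - b|) => c d; nra.
Qed.

(** With [y = E f i q], the product [star y * y] is [E (f^2) q q], which acts on [z] by
    [f(x)^2 = 0]; the C*-identity then removes [star y]. *)
Lemma cone_hom_kill f i q z (x : R) : (1 <= i <= n)%N -> (1 <= q <= n)%N -> 0 <= x <= 1 -> C0 f ->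
  E id q q * z = x%:C *: z -> f x = 0 -> E f i q * z = 0.
Proof.
move=> iN qn x01 f0 xz fx; apply: star_mul_eq0.
rewrite star_mul cone_hom_star// mulrA -[X in X * z]mulrA cone_hom_mul//.
rewrite -mulrA (cone_hom_eigen qn x01 _ xz) ?fx ?mulr0 ?scale0r ?mulr0//.
exact: C0M f0 f0.1.
Qed.

End ConeHom.

(** * Characters from asymptotic eigenvalues *)

Section Excision.
Context {R : realType}.

Lemma real_complete (u : nat -> R) :
  (forall e, 0 < e -> exists N, forall m n, (N <= m)%N -> (N <= n)%N -> `|u m - u n| < e) ->
  exists l, forall e, 0 < e -> exists N, forall n, (N <= n)%N -> `|l - u n| < e.
Proof.
move=> cu; have : cvg (u @ \oo).
  apply/cauchy_cvgP/cauchy_ballP => e e0.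
  have [N hN] := cu _ e0; pose V := u @` [set n | (N <= n)%N].
  exists (V, V); first by split; exists N => // n Nn; exists n.
  by move=> [_ _] [/= [m Nm <-] [n Nn <-]]; exact: hN.
move=> /cvg_ex[l /cvgrPdist_lt ul]; exists l => e e0.
by have [N _ hN] := ul e e0; exists N => n Nn; exact: hN.
Qed.

Lemma complex_complete (u : nat -> R[i]) :
  (forall e, 0 < e -> exists N, forall m n, (N <= m)%N -> (N <= n)%N -> cabs (u m - u n) < e) ->
  exists l, forall e, 0 < e -> exists N, forall n, (N <= n)%N -> cabs (l - u n) < e.
Proof.
move=> cu.
have ReB x y : complex.Re (x - y) = complex.Re x - complex.Re y :> R by case: x y => [? ?] [].
have ImB x y : complex.Im (x - y) = complex.Im x - complex.Im y :> R by case: x y => [? ?] [].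
have [|a ha] := @real_complete (fun n => complex.Re (u n)).
  move=> e /cu[N hN]; exists N => m n Nm Nn; rewrite -ReB.
  exact: le_lt_trans (cabs_Re _) (hN _ _ Nm Nn).
have [|b hb] := @real_complete (fun n => complex.Im (u n)).
  move=> e /cu[N hN]; exists N => m n Nm Nn; rewrite -ImB.
  exact: le_lt_trans (cabs_Im _) (hN _ _ Nm Nn).
exists (a +i* b) => e e0; have e2 : 0 < e / 2 by lra.
have [N hN] := ha _ e2; have [N' hN'] := hb _ e2.
exists (maxn N N') => n; rewrite geq_max => /andP[/hN h1 /hN' h2].
by apply: le_lt_trans (cabs_le _) _; rewrite ReB ImB /=; lra.
Qed.

(** The error is measured relative to the norm of [e k], so the sequence need not be normalised,
    only nonzero. *)
Definition asym_eigen (A : cstarType R) (e : nat -> A) (d : A) (x : R[i]) : Prop :=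
  forall eps, 0 < eps -> exists N, forall k, (N <= k)%N ->
    rnorm (d * e k - x *: e k) <= eps * rnorm (e k).

Variables (A : cstarType R) (e : nat -> A).
Hypothesis e_neq0 : forall k, e k != 0.

Let e_gt0 k : 0 < rnorm (e k).
Proof.
rewrite lt_def rnorm_ge0 andbT; apply: contra (e_neq0 k) => /eqP/rnorm_eq0 ->.
exact: eqxx.
Qed.

Lemma asym_eigen_exact N (d : A) x : (forall k, (N <= k)%N -> d * e k = x *: e k) ->
  asym_eigen e d x.
Proof.
move=> h eps eps0; exists N => k /h ->; rewrite subrr rnorm0.
by rewrite mulr_ge0 ?rnorm_ge0// ltW.
Qed.

Lemma eigen_dist (d d' : A) (x x' : R[i]) (eps eps' : R) k :
  rnorm (d * e k - x *: e k) <= eps * rnorm (e k) ->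
  rnorm (d' * e k - x' *: e k) <= eps' * rnorm (e k) ->
  cabs (x - x') <= rnorm (d - d') + eps + eps'.
Proof.
move=> h h'; rewrite -(ler_pM2r (e_gt0 k)) -rnormZ.
have -> : (x - x') *: e k = (d - d') * e k - ((d * e k - x *: e k) - (d' * e k - x' *: e k)).
  rewrite mulrBl scalerBl; move: (d * _) (d' * _) (x *: _) (x' *: _) => p q r t.
  by rewrite opprB addrA subrKA opprB addrC subrKA.
have := rnormD ((d - d') * e k) (- ((d * e k - x *: e k) - (d' * e k - x' *: e k))).
have := rnormD (d * e k - x *: e k) (- (d' * e k - x' *: e k)).
rewrite !rnormN; have := rnormM (d - d') (e k); rewrite !mulrDl; lra.
Qed.

Lemma asym_eigen_dist (d d' : A) x x' : asym_eigen e d x -> asym_eigen e d' x' ->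
  cabs (x - x') <= rnorm (d - d').
Proof.
move=> dx dx'; apply/ler_addgt0Pr => eps eps0; have eps2 : 0 < eps / 2 by lra.
have [N hN] := dx _ eps2; have [N' hN'] := dx' _ eps2.
have := eigen_dist (hN _ (leq_maxl N N')) (hN' _ (leq_maxr N N')); lra.
Qed.

Lemma asym_eigen_uniq (d : A) x x' : asym_eigen e d x -> asym_eigen e d x' -> x = x'.
Proof.
move=> dx dx'; apply/eqP; rewrite -subr_eq0; apply/eqP/cabs_eq0.
by have := asym_eigen_dist dx dx'; rewrite subrr rnorm0.
Qed.

Lemma asym_eigen_lin a (d d' : A) x x' : asym_eigen e d x -> asym_eigen e d' x' ->
  asym_eigen e (a *: d + d') (a * x + x').
Proof.
move=> dx dx' eps eps0; have a0 := cabs_ge0 a.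
have eps1 : 0 < eps / (2 * (cabs a + 1)) by rewrite divr_gt0//; lra.
have eps2 : 0 < eps / 2 by lra.
have [N hN] := dx _ eps1; have [N' hN'] := dx' _ eps2.
exists (maxn N N') => k; rewrite geq_max => /andP[/hN h1 /hN' h2].
rewrite mulrDl scalerDl -scalerAl opprD addrACA -scalerA -scalerBr.
apply: le_trans (rnormD _ _) _; rewrite rnormZ.
have : cabs a * rnorm (d * e k - x *: e k) <= eps / 2 * rnorm (e k); last by lra.
apply: le_trans (ler_wpM2l a0 h1) _; rewrite mulrA ler_wpM2r ?rnorm_ge0//.
rewrite mulrA ler_pdivrMr; last by lra.
by nra.
Qed.

Lemma asym_eigenM (d d' : A) x x' : asym_eigen e d x -> asym_eigen e d' x' ->
  asym_eigen e (d * d') (x * x').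
Proof.
move=> dx dx' eps eps0; have x0 := cabs_ge0 x'; have d0 := rnorm_ge0 d.
have eps1 : 0 < eps / (2 * (cabs x' + 1)) by rewrite divr_gt0//; lra.
have eps2 : 0 < eps / (2 * (rnorm d + 1)) by rewrite divr_gt0//; lra.
have [N hN] := dx _ eps1; have [N' hN'] := dx' _ eps2.
exists (maxn N N') => k; rewrite geq_max => /andP[/hN h1 /hN' h2].
have -> : d * d' * e k - (x * x') *: e k =
    d * (d' * e k - x' *: e k) + x' *: (d * e k - x *: e k).
  by rewrite mulrBr scalerBr -scalerAr scalerA (mulrC x') mulrA addrA subrK.
apply: le_trans (rnormD _ _) _; rewrite rnormZ.
apply: le_trans (lerD (rnormM _ _) (lexx _)) _.
have : cabs x' * rnorm (d * e k - x *: e k) <= eps / 2 * rnorm (e k).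
  apply: le_trans (ler_wpM2l x0 h1) _; rewrite mulrA ler_wpM2r ?rnorm_ge0//.
  by rewrite mulrA ler_pdivrMr; [nra|lra].
have : rnorm d * rnorm (d' * e k - x' *: e k) <= eps / 2 * rnorm (e k).
  apply: le_trans (ler_wpM2l d0 h2) _; rewrite mulrA ler_wpM2r ?rnorm_ge0//.
  by rewrite mulrA ler_pdivrMr; [nra|lra].
lra.
Qed.

(** By [asym_eigen_dist] eigenvalues of nearby elements are as close as the elements, so those of
    the approximants form a Cauchy sequence; its limit is the eigenvalue. *)
Lemma asym_eigen_limit (d : A) :
  (forall eps, 0 < eps -> exists d' x', rnorm (d - d') < eps /\ asym_eigen e d' x') ->
  exists x, asym_eigen e d x.
Proof.
move=> h; have h' (n : nat) : exists p : A * R[i],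
    rnorm (d - p.1) < n.+1%:R^-1 /\ asym_eigen e p.1 p.2.
  have [|d' [x' hd]] := h n.+1%:R^-1; first by rewrite invr_gt0.
  by exists (d', x').
pose u n := projT1 (cid (h' n)).
have [ud ux] : (forall n, rnorm (d - (u n).1) < n.+1%:R^-1) /\
    forall n, asym_eigen e (u n).1 (u n).2.
  by split=> n; rewrite /u; case: cid => p [].
have inv_small eps : 0 < eps -> exists N, forall n, (N <= n)%N -> n.+1%:R^-1 < eps :> R.
  move=> eps0; exists (Num.truncn eps^-1) => n Nn.
  rewrite invf_plt ?posrE//; apply: lt_le_trans (Num.Theory.truncnS_gt _) _.
  by rewrite ler_nat ltnS.
have [|x hx] := @complex_complete (fun n => (u n).2).
  move=> eps eps0; have [|N hN] := inv_small (eps / 2); first by lra.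
  exists N => m n Nm Nn; apply: le_lt_trans (asym_eigen_dist (ux m) (ux n)) _.
  have := rnorm_triangle (u m).1 d (u n).1; rewrite (rnormB _ d).
  have h1 := lt_trans (ud m) (hN _ Nm); have h2 := lt_trans (ud n) (hN _ Nn).
  move=> /le_lt_trans; apply; rewrite [eps]splitr; exact: ltrD h1 h2.
exists x => eps eps0; have eps3 : 0 < eps / 3 by lra.
have [N1 hN1] := inv_small _ eps3; have [N2 hN2] := hx _ eps3.
pose n := maxn N1 N2; have := hN1 n (leq_maxl _ _); have := hN2 n (leq_maxr _ _).
have := ud n; have [N hN] := ux n _ eps3; set d' := (u n).1; set x' := (u n).2.
move=> dd' xx' ni; exists N => k /hN; rewrite -/d' -/x' => hk.
have -> : d * e k - x *: e k = (d - d') * e k + (d' * e k - x' *: e k) - (x - x') *: e k.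
  by rewrite mulrBl scalerBl subrKA opprB subrKA.
have := rnormD ((d - d') * e k + (d' * e k - x' *: e k)) (- ((x - x') *: e k)).
have := rnormD ((d - d') * e k) (d' * e k - x' *: e k).
rewrite rnormN rnormZ; have := rnormM (d - d') (e k).
have h1 : rnorm (d - d') * rnorm (e k) <= eps / 3 * rnorm (e k).
  by rewrite ler_wpM2r ?rnorm_ge0// ltW// (lt_trans dd').
have h2 : cabs (x - x') * rnorm (e k) <= eps / 3 * rnorm (e k).
  by rewrite ler_wpM2r ?rnorm_ge0// ltW.
lra.
Qed.

(** Eigenvalues are unique, so the map sending [d] to its eigenvalue inherits linearity and
    multiplicativity from [asym_eigen_lin] and [asym_eigenM]; the element with eigenvalue 1 makes it
    nonzero. *)
Lemma excision_character (D : set A) :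
  (forall d, D d -> exists x, asym_eigen e d x) -> (exists2 d, D d & asym_eigen e d 1) ->
  exists chi : D -> R[i], character chi /\ forall d, asym_eigen e (\val d) (chi d).
Proof.
move=> hD [d1 Dd1 ed1].
pose chi (d : D) := projT1 (cid (hD _ (set_valP d))).
have hchi d : asym_eigen e (\val d) (chi d) by rewrite /chi; case: cid.
exists chi; split=> //; split.
- move=> a x y z zxy; apply: (asym_eigen_uniq (hchi z)).
  by rewrite zxy; exact: asym_eigen_lin.
- move=> x y z zxy; apply: (asym_eigen_uniq (hchi z)).
  by rewrite zxy; exact: asym_eigenM.
pose d1' : D := exist _ d1 (mem_set Dd1); exists d1'.
by rewrite (asym_eigen_uniq (d := d1) (hchi d1') ed1) oner_neq0.
Qed.

End Excision.

(** * The functions g and h *)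

Section Block.
Context {R : realType}.
Local Notation I := (set_type (`[0, 1] : set R)).
Local Notation g := (@g_fun R).
Local Notation h := (@h_fun R).

Lemma g_funE (t : R) : g t = if 4 * t < 1 then 4 * t else 1.
Proof. by rewrite /g_fun minElt. Qed.

Lemma h_funE (t : R) : h t = if 3 / 4 < t then 4 * t - 3 else 0.
Proof.
rewrite /h_fun maxElt (_ : (0 < 4 * (t - 3 / 4)) = (3 / 4 < t)); first by case: ifP => // _; field.
by apply/idP/idP => ?; lra.
Qed.

Lemma g_fun_eq1 (t : R) : 1 / 4 <= t -> g t = 1.
Proof. by move=> t4; rewrite g_funE; case: ltP => //; lra. Qed.

Lemma h_fun_eq0 (t : R) : t <= 3 / 4 -> h t = 0.
Proof. by move=> t4; rewrite h_funE; case: ltP => //; lra. Qed.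

Lemma h_fun1 : h 1 = 1.
Proof. by rewrite h_funE; case: ltP => //; lra. Qed.

Lemma g_fun0 : g 0 = 0.
Proof. by rewrite g_funE; case: ltP => //; lra. Qed.

Lemma g_fun_ge0 (t : R) : 0 <= t -> 0 <= g t.
Proof. by move=> t0; rewrite g_funE; case: ifP => // _; lra. Qed.

Lemma h_fun_ge0 (t : R) : 0 <= h t.
Proof. by rewrite h_funE; case: ltP => // ?; lra. Qed.

Lemma h_fun_le_g (t : R) : 0 <= t <= 1 -> h t <= g t.
Proof.
move=> /andP[t0 t1]; rewrite h_funE g_funE; case: ltP => a; case: ltP => b; lra.
Qed.

Lemma C0_g : C0 g.
Proof.
split=> [t|]; last exact: g_fun0.
apply: (@continuous_min R R (fun t => 4 * t) (fun=> 1) t); last exact: cst_continuous.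
by apply: cvgM; [exact: cvg_cst|exact: cvg_id].
Qed.

Lemma C0_h : C0 h.
Proof.
split=> [t|]; last by rewrite h_fun_eq0//; lra.
apply: (@continuous_max R R (fun=> 0) (fun t => 4 * (t - 3 / 4)) t); first exact: cst_continuous.
by apply: cvgM; [exact: cvg_cst|apply: cvgB; [exact: cvg_id|exact: cvg_cst]].
Qed.

Lemma C0_sqrt (f : R -> R) : C0 f -> C0 (fun t => Num.sqrt (f t)).
Proof.
move=> [cf f0]; split=> [t|]; last by rewrite f0 sqrtr0.
apply: continuous_comp; [exact: cf|exact: sqrt_continuous].
Qed.

Lemma C0_scale (a : R) (f : R -> R) : C0 f -> C0 (fun t => a * f t).
Proof.
move=> [cf f0]; split=> [t|]; last by rewrite f0 mulr0.
by apply: cvgM; [exact: cvg_cst|exact: cf].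
Qed.

Lemma C0B (f1 f2 : R -> R) : C0 f1 -> C0 f2 -> C0 (fun t => f1 t - f2 t).
Proof.
move=> [cf f0] [cf' f0']; split=> [t|]; last by rewrite f0 f0' subrr.
by apply: cvgB; [exact: cf|exact: cf'].
Qed.

Lemma sum_nat_zero (V : nmodType) (F : nat -> V) m :
  (forall i, (1 <= i <= m)%N -> F i = 0) -> \sum_(1 <= i < m.+1) F i = 0.
Proof. by move=> F0; rewrite big_nat_cond big1// => i; rewrite andbT => /F0. Qed.

Lemma sum_nat_single (V : nmodType) (F : nat -> V) m i0 : (1 <= i0 <= m)%N ->
  (forall i, (1 <= i <= m)%N -> i != i0 -> F i = 0) -> \sum_(1 <= i < m.+1) F i = F i0.
Proof.
move=> i0m F0; rewrite (bigD1_seq i0) ?iota_uniq//=; last by rewrite mem_index_iota.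
rewrite big_nat_cond big1 ?addr0// => i /andP[im ii0]; exact: F0.
Qed.

(** * Nonvanishing of the bump elements *)

Section Relations.
Variables (A : cstarType R) (n : nat) (Psi : (I -> 'M[R[i]]_n) -> A).
Hypothesis hPsi : cone_star_hom Psi.
Variables (c : nat -> A) (s : A).
Hypothesis hc : forall i, (1 <= i <= n)%N -> Psi (elt_tensor n Num.sqrt 1 i) = c i.
Hypothesis cs : c 1%N * s = s.
Hypothesis hsum : \sum_(1 <= l < n.+1) star (c l) * c l + star s * s = 1.
Hypothesis n0 : (1 <= n)%N.
Local Notation E f i j := (Psi (elt_tensor n f i j)).

Let n1 : (1 <= 1 <= n)%N. Proof. by rewrite n0. Qed.
Let sqrt0 : C0 (@Num.sqrt R). Proof. exact: C0_sqrt (@C0_id R). Qed.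

Lemma star_cc i : (1 <= i <= n)%N -> star (c i) * c i = E id i i.
Proof.
move=> iN; rewrite -hc// cone_hom_star// cone_hom_mul//; congr Psi.
by apply: elt_tensor_ext => t /andP[t0 _]; rewrite -expr2 sqr_sqrtr.
Qed.

Lemma cone_hom_h_fun_neq0 q : (1 <= q <= n)%N -> E h q q != 0.
Proof.
move=> qn; apply/eqP => hq; have h0 := C0_h; have sh0 := C0_sqrt h0.
have sh t : Num.sqrt (h t) * Num.sqrt (h t) = h t by rewrite -expr2 sqr_sqrtr// h_fun_ge0.
(* Diagonal corners are equivalent: the entry of [sqrt h] at [(j, i)] links the corners [i] and [j],
   so [h] vanishes on all of them or on none. *)
have hij i j : (1 <= i <= n)%N -> (1 <= j <= n)%N -> E h i i = 0 -> E h j j = 0.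
  move=> iN jN hi; have : E (fun t => Num.sqrt (h t)) j i = 0.
    apply: star_mul_eq0; rewrite cone_hom_star// cone_hom_mul//.
    by rewrite -[RHS]hi; congr Psi; apply: elt_tensor_ext => t _; exact: sh.
  move=> ji.
  rewrite (_ : E h j j = E (fun t => Num.sqrt (h t)) j i * E (fun t => Num.sqrt (h t)) i j).
    by rewrite ji mul0r.
  by rewrite cone_hom_mul//; congr Psi; apply: elt_tensor_ext => t _; rewrite sh.
have hall j : (1 <= j <= n)%N -> E h j j = 0 by move=> jn; exact: hij hq.
have i01 : 0 <= (1 : R) <= 1 by rewrite ler01 lexx.
(* Since [h 1 = 1], an eigenvector for the value 1 is fixed by [E h j j], which is 0. *)
have eig j z : (1 <= j <= n)%N -> E id j j * z = z -> z = 0.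
  move=> jn jz; have := cone_hom_eigen hPsi jn i01 h0 (z := z).
  by rewrite h_fun1 scale1r (hall _ jn) mul0r => /(_ jz)/esym.
have s0 : s = 0.
  apply: (eig 1%N) => //; rewrite -star_cc// -mulrA cs.
  have <- : c 1%N = star (c 1%N) by rewrite -hc// cone_hom_star.
  exact: cs.
(* With [s = 0], multiplying the sum relation by [E id j j] shows that it is idempotent, so [eig]
   applies to it. *)
have cc0 j : (1 <= j <= n)%N -> E id j j = 0.
  move=> jn; apply: (eig j) => //.
  have id0 := @C0_id R.
  rewrite -[RHS]mulr1 -hsum s0 mulr0 addr0 mulr_sumr (@sum_nat_single _ _ _ j)//.
    by rewrite star_cc.
  by move=> i iN ij; rewrite star_cc// cone_hom_mul0// eq_sym.
have := hsum; rewrite s0 mulr0 addr0 sum_nat_zero => [/esym/eqP|i iN].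
  by rewrite oner_eq0.
by rewrite star_cc// cc0.
Qed.

End Relations.

End Block.

(** * The connecting maps *)

(** The columns split into [L] blocks, each with [K M L] columns of weight [g] followed by [M]
    columns of weights [g - (i/M) h]. *)
Lemma next_LE L M K : next_L L M K = (L * (K * M * L + M))%N.
Proof. rewrite /next_L expnS expn1; lia. Qed.

Section ConnectingMap.
Context {R : realType}.
Local Notation I := (set_type (`[0, 1] : set R)).
Local Notation g := (@g_fun R).
Local Notation h := (@h_fun R).
Variables (A : cstarType R) (L M K : nat).
Hypotheses (L2 : (2 <= L)%N) (M2 : (2 <= M)%N) (K2 : (2 <= K)%N).
Local Notation K' := (K * M * L)%N.
Local Notation W := (K' + M)%N.
Local Notation n := (next_L L M K).
Variable Psi : (I -> 'M[R[i]]_n) -> A.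
Hypothesis hPsi : cone_star_hom Psi.
Local Notation E f i j := (Psi (elt_tensor n f i j)).

Let sg (t : R) := Num.sqrt (g t).
Let u i (t : R) := Num.sqrt (g t - i%:R / M%:R * h t).
Let v i (t : R) := Num.sqrt (i%:R / M%:R * h t).

Let sg0 : C0 sg. Proof. exact: C0_sqrt (@C0_g R). Qed.
Let gh0 i : C0 (fun t => g t - i%:R / M%:R * h t).
Proof. by apply: C0B; [exact: C0_g|apply: C0_scale; exact: C0_h]. Qed.
Let u0 i : C0 (u i). Proof. exact: C0_sqrt. Qed.
Let v0 i : C0 (v i). Proof. by apply: C0_sqrt; apply: C0_scale; exact: C0_h. Qed.

Lemma leW_n : (W <= n)%N.
Proof. by rewrite next_LE leq_pmull//; lia. Qed.

(** The [Psi] part of [s_tilde] uses rows up to [L M + 1] only, so row [K'] is free of it. *)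
Let K'_gt : (L * M + 1 < K')%N.
Proof. nia. Qed.

Lemma col_bound l i : (1 <= l <= L)%N -> (1 <= i <= W)%N -> (1 <= l.-1 * W + i <= n)%N.
Proof. by rewrite next_LE; move=> /andP[l1 lL] /andP[i1 iW]; nia. Qed.

Lemma c_tildeE l : (1 <= l)%N -> c_tilde Psi l =
  \sum_(1 <= i < K'.+1) E sg i (l.-1 * W + i) +
  \sum_(1 <= i < M.+1) E (u i) (K' + i) (l.-1 * W + (K' + i)).
Proof.
move=> l1; congr (_ + _); apply: eq_bigr => i _; congr (E _ _ _); nia.
Qed.

Let row1 i : (1 <= i <= K')%N -> (1 <= i <= n)%N.
Proof. by move=> iK; have := leW_n; lia. Qed.
Let row2 i : (1 <= i <= M)%N -> (1 <= K' + i <= n)%N.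
Proof. by move=> iM; have := leW_n; lia. Qed.
Let col1 l i : (1 <= l <= L)%N -> (1 <= i <= K')%N -> (1 <= l.-1 * W + i <= n)%N.
Proof. by move=> lL iK; apply: col_bound => //; lia. Qed.
Let col2 l i : (1 <= l <= L)%N -> (1 <= i <= M)%N -> (1 <= l.-1 * W + (K' + i) <= n)%N.
Proof. by move=> lL iM; apply: col_bound => //; lia. Qed.

(** Column [W] closes the first block and carries the weight [sqrt (g - h)], which vanishes at 1. So
    both alternatives, value 0 at a column or value 1 at column [W], kill the corresponding term. *)
Lemma c_tilde_kill z l : (1 <= l <= L)%N ->
  (forall j, (1 <= j <= n)%N -> E id j j * z = 0 \/ j = W /\ E id j j * z = z) ->
  c_tilde Psi l * z = 0.
Proof.
move=> lL hz; have l1 : (1 <= l)%N by lia.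
have i00 : 0 <= (0 : R) <= 1 by rewrite lexx ler01.
have i01 : 0 <= (1 : R) <= 1 by rewrite lexx ler01.
have kill f i j : (1 <= i <= n)%N -> (1 <= j <= n)%N -> C0 f -> E id j j * z = 0 ->
    E f i j * z = 0.
  by move=> iN jN f0 jz; apply: (cone_hom_kill hPsi iN jN i00 f0) f0.2; rewrite jz scale0r.
rewrite c_tildeE// mulrDl !mulr_suml !sum_nat_zero ?addr0// => i iN.
  have [jz|[jW jz]] := hz _ (col2 lL iN); first by apply: kill; [exact: row2|exact: col2| |].
  (* Column [W] equals [l.-1 * W + (K' + i)] only for [l = 1] and [i = M]. *)
  have iM : i = M by nia.
  apply: (cone_hom_kill hPsi (row2 iN) (col2 lL iN) i01 (u0 i)); first by rewrite jz scale1r.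
  rewrite iM /u divff ?mul1r ?pnatr_eq0; last by lia.
  by rewrite h_fun1 g_fun_eq1 ?subrr ?sqrtr0//; lra.
have [jz|[jW jz]] := hz _ (col1 lL iN); first by apply: kill; [exact: row1|exact: col1| |].
nia.
Qed.

(** Here [q] is the last column of weight [g] in block [l], placed in row [K']. As [g = 1] wherever
    [h] is nonzero, [c_tilde l] moves [E h q q] to row [K'] and back without loss. *)
Lemma c_tilde_excise l (q := (l.-1 * W + K')%N) : (1 <= l <= L)%N ->
  c_tilde Psi l * E h q q = E h K' q /\ star (c_tilde Psi l) * E h K' q = E h q q.
Proof.
move=> lL; have l1 : (1 <= l)%N by lia.
have K1 : (1 <= K' <= K')%N by lia.
have qn : (1 <= q <= n)%N by exact: col1.
have h0 := @C0_h R; have sgh i j : E (fun t => sg t * h t) i j = E h i j.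
  congr Psi; apply: elt_tensor_ext => t _; rewrite /sg.
  have [t4|t4] := leP t (3 / 4); first by rewrite h_fun_eq0// mulr0.
  by rewrite g_fun_eq1 ?sqrtr1 ?mul1r//; lra.
split.
  rewrite c_tildeE// mulrDl !mulr_suml (@sum_nat_single _ _ _ K')//.
    rewrite sum_nat_zero ?addr0 => [|i iN]; first by rewrite cone_hom_mul// sgh.
    by rewrite cone_hom_mul0//; [exact: col2|rewrite /q; lia].
  by move=> i iN iK; rewrite cone_hom_mul0//; [exact: col1|rewrite /q; lia].
rewrite c_tildeE// starD !star_sum mulrDl !mulr_suml (@sum_nat_single _ _ _ K')//.
  rewrite sum_nat_zero ?addr0 => [|i iN].
    by rewrite cone_hom_star// cone_hom_mul ?sgh//; exact: row1.
  by rewrite cone_hom_star// cone_hom_mul0//; [exact: row2|lia].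
by move=> i iN iK; rewrite cone_hom_star// cone_hom_mul0//; exact: row1.
Qed.

(** The first block sits on the diagonal, so [c_tilde Psi 1] is the diagonal element with weights
    [w i]. *)
Let w i := if (i <= K')%N then sg else u (i - K').

Let w0 i : C0 (w i). Proof. by rewrite /w; case: ifP. Qed.

Lemma c_tilde1E : c_tilde Psi 1 = \sum_(1 <= i < W.+1) E (w i) i i.
Proof.
rewrite c_tildeE// (@big_cat_nat _ _ _ K'.+1 1 W.+1)//=; last by rewrite ltnS leq_addr.
congr (_ + _).
  by rewrite !big_nat; apply: eq_bigr => i iK; rewrite mul0n add0n /w (_ : i <= K')%N//; lia.
rewrite -[K'.+1]addn1 (addnC K' 1%N) big_addn (_ : W.+1 - K' = M.+1)%N; last by lia.
rewrite !big_nat; apply: eq_bigr => i iM; rewrite mul0n add0n /w addnC addnK.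
by rewrite (_ : (i + K' <= K')%N = false)//; apply/negbTE; lia.
Qed.

Lemma c_tilde1_diag f q : C0 f -> (1 <= q <= W)%N ->
  c_tilde Psi 1 * E f q q = E (fun t => w q t * f t) q q.
Proof.
move=> f0 qW; have iN i : (1 <= i <= W)%N -> (1 <= i <= n)%N by have := leW_n; lia.
rewrite c_tilde1E mulr_suml (@sum_nat_single _ _ _ q)//.
  by rewrite (cone_hom_mul hPsi)// iN.
by move=> i iW iq; rewrite (cone_hom_mul0 hPsi)// iN.
Qed.

Lemma star_c_tilde1 : star (c_tilde Psi 1) = c_tilde Psi 1.
Proof. by rewrite c_tilde1E star_sum; apply: eq_bigr => i _; rewrite (cone_hom_star hPsi). Qed.

(** Cutting down by a single corner puts the product inside the cone over that corner, the form that
    [character_value_one] takes as input. *)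
Lemma c_tilde1_cc_first :
  star (c_tilde Psi 1) * c_tilde Psi 1 * E id 1 1 = E (fun t => g t * t) 1 1.
Proof.
have id0 := @C0_id R; have W1 : (1 <= 1 <= W)%N by nia.
rewrite star_c_tilde1 -mulrA !c_tilde1_diag//; last exact: C0M (w0 1) id0.1.
congr Psi; apply: elt_tensor_ext => t /andP[t0 _].
by rewrite mulrA /w (_ : 1 <= K')%N; [rewrite /sg -expr2 sqr_sqrtr ?g_fun_ge0|nia].
Qed.

Lemma c_tilde1_cc_last :
  star (c_tilde Psi 1) * c_tilde Psi 1 * E id W W = E (fun t => (g t - h t) * t) W W.
Proof.
have id0 := @C0_id R; have W1 : (1 <= W <= W)%N by nia.
rewrite star_c_tilde1 -mulrA !c_tilde1_diag//; last exact: C0M (w0 W) id0.1.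
congr Psi; apply: elt_tensor_ext => t t01.
rewrite mulrA /w (_ : (W <= K')%N = false); last by apply/negbTE; nia.
rewrite addKn /u -expr2 sqr_sqrtr divff ?mul1r ?pnatr_eq0 ?subr_ge0 ?h_fun_le_g//; lia.
Qed.

Section STilde.
Variables (Theta : (I -> 'M[R[i]]_2) -> A) (c : nat -> A) (s : A).
Hypothesis hTheta : cone_star_hom Theta.
Hypothesis hc : forall i, (1 <= i <= n)%N -> E Num.sqrt 1 i = c i.
Hypothesis hs : Theta (elt_tensor 2 Num.sqrt 1 2) = s.
Hypothesis cs : c 1%N * s = s.

(** The [Psi] part misses row [K'] by [K'_gt]. For the [Theta] part, [s = c_1 s] places [s * star s]
    in row 1, so it annihilates row [K'], and [h 0 = 0] finishes. *)
Lemma s_tilde_excise q : (1 <= q <= n)%N -> star (s_tilde Psi Theta) * E h K' q = 0.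
Proof.
move=> qn; have h0 := @C0_h R; have sqrt0 : C0 (@Num.sqrt R) by exact: C0_sqrt (@C0_id R).
have n1 : (1 <= 1 <= n)%N by have := leW_n; lia.
have i00 : 0 <= (0 : R) <= 1 by rewrite lexx ler01.
have Th0 : Theta (elt_tensor 2 id 1 1) * E h K' q = 0.
  have -> : Theta (elt_tensor 2 id 1 1) = s * star s.
    rewrite -hs (cone_hom_star hTheta)// (cone_hom_mul hTheta)//.
    by congr Theta; apply: elt_tensor_ext => t /andP[t0 _]; rewrite -expr2 sqr_sqrtr.
  rewrite -mulrA -cs star_mul -hc// (cone_hom_star hPsi)// -[_ * _ * E _ _ _]mulrA.
  by rewrite (cone_hom_mul0 hPsi) ?mulr0//; nia.
rewrite starD mulrDl star_sum mulr_suml sum_nat_zero ?addr0 => [|l lL].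
  rewrite (cone_hom_star hTheta); last exact: C0_sqrt.
  apply: (cone_hom_kill hTheta (i := 2) (q := 1) isT isT i00 (C0_sqrt h0)).
    by rewrite Th0 scale0r.
  by rewrite h_fun_eq0 ?sqrtr0//; lra.
rewrite star_sum mulr_suml sum_nat_zero// => i iM.
rewrite (cone_hom_star hPsi); last exact: v0.
apply: (cone_hom_mul0 hPsi) => //; [|by nia|exact: v0].
have := leW_n; nia.
Qed.

End STilde.
End ConnectingMap.

(** * Generators of the diagonal *)

Section Generators.
Context {R : realType}.

Definition Dtilde_gens (A : cstarType R) (L : nat) (c : nat -> A) (s : A) : set A :=
  [set star (c i) * c i | i in [set i | (1 <= i <= L)%N]]
  `|` [set star s * s]
  `|` [set star (c i) * s * star s * c i | i in [set i | (1 <= i <= L)%N]]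
  `|` [set x | exists i j, [/\ (1 <= i <= L)%N, (1 <= j <= L)%N
        & x = star (c j) * s * star (c i) * c i * star s * c j]].

Lemma Dtilde_gens_star (A : cstarType R) L (c : nat -> A) s d :
  Dtilde_gens L c s d -> star d = d.
Proof.
case=> [[[[i _ <-]|->]|[i _ <-]]|[i [j [_ _ ->]]]]; rewrite !star_mul !starK ?mulrA//.
Qed.

Lemma Dtilde_gens_hom (A B : cstarType R) (f : A -> B) L (c : nat -> A) s d : star_hom f ->
  Dtilde_gens L c s d -> Dtilde_gens L (f \o c) (f s) (f d).
Proof.
move=> [_ [_ fM] fs]; case=> [[[[i iL <-]|->]|[i iL <-]]|[i [j [iL jL ->]]]]; rewrite !fM ?fs.
- by left; left; left; exists i.
- by left; left; right.
- by left; right; exists i.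
- by right; exists i, j.
Qed.

Section Eigen.
Variables (A : cstarType R) (L : nat) (c : nat -> A) (s : A).
Hypothesis hsum : \sum_(1 <= l < L.+1) star (c l) * c l + star s * s = 1.

(** The condition on [star s * c i] kills both mixed families of generators, and the sum relation
    determines [star s * s]. The eigenvalue is chosen before [z], so that one value serves a whole
    tail of a thread. *)
Lemma eigen_gens (a : nat -> R[i]) d : Dtilde_gens L c s d ->
  exists x : R[i], forall z, (forall i, (1 <= i <= L)%N -> star (c i) * c i * z = a i *: z) ->
    (forall i, (1 <= i <= L)%N -> star s * c i * z = 0) -> d * z = x *: z.
Proof.
case=> [[[[i iL <-]|->]|[i iL <-]]|[i [j [iL jL ->]]]].
- by exists (a i) => z /(_ _ iL).
- exists (1 - \sum_(1 <= l < L.+1) a l) => z hz _.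
  rewrite (_ : star s * s = 1 - \sum_(1 <= l < L.+1) star (c l) * c l); last first.
    by rewrite -hsum addrC addKr.
  rewrite mulrBl mul1r scalerBl scale1r mulr_suml scaler_suml; congr (_ - _).
  by rewrite !big_nat; apply: eq_bigr => i /hz.
- by exists 0 => z _ /(_ _ iL); rewrite -!mulrA => ->; rewrite !mulr0 scale0r.
- by exists 0 => z _ /(_ _ jL); rewrite -!mulrA => ->; rewrite !mulr0 scale0r.
Qed.

Lemma kill_star_ss z : (forall i, (1 <= i <= L)%N -> c i * z = 0) -> star s * s * z = z.
Proof.
move=> hz; rewrite (_ : star s * s = 1 - \sum_(1 <= l < L.+1) star (c l) * c l); last first.
  by rewrite -hsum addrC addKr.
rewrite mulrBl mul1r mulr_suml sum_nat_zero ?subr0// => i /hz iz.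
by rewrite -mulrA iz mulr0.
Qed.

Hypothesis hortho : forall i j, (1 <= i <= L)%N -> (1 <= j <= L)%N -> i != j ->
  (star (c i) * c i) * (star (c j) * c j) = 0.

Lemma ortho_kill q j z : (1 <= q <= L)%N -> (1 <= j <= L)%N -> j != q ->
  star (c q) * c q * z = z -> c j * z = 0.
Proof.
move=> qL jL jq qz; apply: star_mul_eq0.
by rewrite star_mul -mulrA [star (c j) * _]mulrA -qz [_ * (_ * z)]mulrA hortho// mul0r mulr0.
Qed.

End Eigen.

(** The elements [d] such that [d] and [star d] both have an eigenvalue form a C*-subalgebra. The
    adjoint is carried along because left multiplication on [e] gives no information about it;
    closedness uses contractivity of [f]. *)
Lemma asym_eigen_generated (Z A : cstarType R) (f : Z -> A) (e : nat -> A) (G : set Z) :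
  star_hom f -> (forall k, e k != 0) -> (forall d, G d -> star d = d) ->
  (forall d, G d -> exists x, asym_eigen e (f d) x) ->
  forall d, cstar_generated G d -> exists x, asym_eigen e (f d) x.
Proof.
move=> hf e0 Gs Ge d; have [flin [_ fM] fs] := hf.
pose S := [set d : Z | (exists x, asym_eigen e (f d) x) /\ (exists x, asym_eigen e (f (star d)) x)].
suff : cstar_generated G `<=` S by move=> h /h[].
apply: smallest_sub; last by move=> d' Gd'; split; rewrite ?Gs//; exact: Ge.
split.
- have h0 : exists x, asym_eigen e (f 0) x.
    by exists 0; apply: (asym_eigen_exact (N := 0%N)) => k _; rewrite (star_hom0 hf) mul0r scale0r.
  by split; rewrite ?star0.
- move=> a x y [[x1 hx1] [x2 hx2]] [[y1 hy1] [y2 hy2]]; split.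
    by exists (a * x1 + y1); rewrite flin; exact: asym_eigen_lin.
  by exists (Num.conj a * x2 + y2); rewrite starD starZ flin; exact: asym_eigen_lin.
- move=> x y [[x1 hx1] [x2 hx2]] [[y1 hy1] [y2 hy2]]; split.
    by exists (x1 * y1); rewrite fM; exact: asym_eigenM.
  by exists (y2 * x2); rewrite star_mul fM; exact: asym_eigenM.
- by move=> x [h1 h2]; split; rewrite ?starK.
apply/closedP => x hx.
have fB y : rnorm (f x - f y) <= rnorm (x - y).
  by rewrite -(star_homB hf); exact: star_hom_contractive.
split; apply: asym_eigen_limit => // eps eps0; have [y [[x1 hy1] [x2 hy2]] xy] := hx _ eps0.
  by exists (f y), x1; split=> //; exact: le_lt_trans (fB _) xy.
exists (f (star y)), x2; split=> //; rewrite !fs -starB rnorm_star.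
exact: le_lt_trans (fB _) xy.
Qed.

End Generators.

(** * Characters of the limit diagonal *)

Section Spectrum.
Context {R : realType}.
Local Notation I := (set_type (`[0, 1] : set R)).

(** [G] acts on the corner of [a] as the function [f], and [f = 1] near the value of [a] forces
    [chi G = 1]. The argument is purely algebraic: neither continuity of [chi] nor reality of
    [chi a] is presupposed. *)
Lemma character_value_one (A : cstarType R) (D : set A) (chi : D -> R[i]) (hchi : character chi)
  n (Psi : (I -> 'M[R[i]]_n) -> A) (hPsi : cone_star_hom Psi) q (qn : (1 <= q <= n)%N)
  (DE : forall f, C0 f -> D (Psi (elt_tensor n f q q)))
  (f : R -> R) (f0 : C0 f) (a G : D) :
  \val a = Psi (elt_tensor n id q q) ->
  \val G * \val a = Psi (elt_tensor n (fun t => f t * t) q q) ->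
  chi a != 0 -> (forall t, 0 <= t <= 1 -> `|t - complex.Re (chi a)| <= 1 / 4 -> f t = 1) ->
  chi G = 1.
Proof.
(* [P] is the real polynomial with root [chi a], and [(f t - 1) * t] is its    *)
(* product with a function [k] in [C0], on which [chi] can be evaluated.      *)
move=> aE GaE x0 f1; have [hl hm _] := hchi.
set x := chi a in x0 f1 *; pose r := complex.Re x; pose b := complex.Im x.
pose P t := (t - r) ^+ 2 + b ^+ 2.
(* The floor [1/16 = (1/4)^2] keeps the denominator positive and changes [P] only within distance
   1/4 of [r], where the numerator of [k] vanishes. *)
pose Q t := Num.max (P t) (1 / 16).
pose k t := (f t - 1) * t / Q t.
have id0 := @C0_id R.
have Qgt0 t : 0 < Q t.
  by rewrite /Q lt_max; apply/orP; right; lra.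
have k0 : C0 k.
  split=> [t|]; last by rewrite /k mulr0 mul0r.
  apply: cvgM; first by apply: cvgM; [apply: cvgB; [exact: f0.1|exact: cvg_cst]|exact: cvg_id].
  apply: cvgV; first by rewrite gt_eqF.
  apply: (@continuous_max R R P (fun=> 1 / 16) t); last exact: cst_continuous.
  apply: cvgD; last exact: cvg_cst.
  by apply: cvgM; apply: cvgB; (exact: cvg_id || exact: cvg_cst).
have kP t : 0 <= t <= 1 -> f t * t = P t * k t + t.
  move=> t01; rewrite /k; have [t4|t4] := leP (`|t - r|) (1 / 4).
    by rewrite (f1 _ t01 t4) subrr !mul0r mulr0 add0r mul1r.
  have -> : Q t = P t.
    rewrite /Q; apply/max_idPl; rewrite /P.
    have : (1 / 4) ^+ 2 <= (t - r) ^+ 2.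
      by rewrite -[X in _ <= X]real_normK ?num_real// ler_pXn2r ?nnegrE//; lra.
    have := sqr_ge0 b; lra.
  have P0 : P t != 0.
    have : 0 < (t - r) ^+ 2 by rewrite -real_normK ?num_real// exprn_gt0//; lra.
    by move=> ?; rewrite gt_eqF// /P ltr_wpDr// sqr_ge0.
  by rewrite [P t * _]mulrC divfK//; lra.
pose F f (hf : C0 f) : D := exist _ (Psi (elt_tensor n f q q)) (mem_set (DE f hf)).
have tk0 : C0 (fun t => t * k t) by exact: C0M id0 k0.1.
have ttk0 : C0 (fun t => t * (t * k t)) by exact: C0M id0 tk0.1.
have aF : chi (F _ id0) = x.
  by congr chi; apply: val_inj; rewrite aE.
have tkE : chi (F _ tk0) = x * chi (F _ k0).
  by rewrite -aF; apply: hm; rewrite /= (cone_hom_mul hPsi).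
have ttkE : chi (F _ ttk0) = x * (x * chi (F _ k0)).
  by rewrite -tkE -aF; apply: hm; rewrite /= (cone_hom_mul hPsi).
pose m1 t := (r ^+ 2 + b ^+ 2) * k t + t.
have m10 : C0 m1 by exact: C0_lin.
pose m2 t := (- (2 * r)) * (t * k t) + m1 t.
have m20 : C0 m2 by exact: C0_lin.
pose m3 t := 1 * (t * (t * k t)) + m2 t.
have m30 : C0 m3 by exact: C0_lin.
have m1E : chi (F _ m10) = (r ^+ 2 + b ^+ 2)%:C * chi (F _ k0) + x.
  by rewrite -aF; apply: hl; rewrite /= -(cone_homDZ hPsi).
have m2E : chi (F _ m20) = (- (2 * r))%:C * chi (F _ tk0) + chi (F _ m10).
  by apply: hl; rewrite /= -(cone_homDZ hPsi).
have m3E : chi (F _ m30) = 1 * chi (F _ ttk0) + chi (F _ m20).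
  by apply: hl; rewrite /= -[1 in RHS](rmorph1 (@real_complex R)) -(cone_homDZ hPsi).
have GaF : chi G * x = chi (F _ m30).
  symmetry; apply: hm; rewrite GaE /=; congr Psi; apply: elt_tensor_ext => t t01.
  by rewrite kP// /m3 /m2 /m1 /P; ring.
have xroot : x * x + (- (2 * r))%:C * x + (r ^+ 2 + b ^+ 2)%:C = 0.
  rewrite /r /b; move: (x) => [u w]; apply/eqP; rewrite eq_complex /=.
  by apply/andP; split; apply/eqP; ring.
have : chi G * x = x.
  rewrite GaF m3E m2E m1E ttkE tkE; set y := chi _.
  have -> : 1 * (x * (x * y)) + ((- (2 * r))%:C * (x * y) + ((r ^+ 2 + b ^+ 2)%:C * y + x)) =
    (x * x + (- (2 * r))%:C * x + (r ^+ 2 + b ^+ 2)%:C) * y + x by ring.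
  by rewrite xroot mul0r add0r.
by move/eqP; rewrite -subr_eq0 -{2}[x]mul1r -mulrBl mulf_eq0 (negbTE x0) orbF subr_eq0 => /eqP.
Qed.

Lemma asym_eigen_closure (A : cstarType R) (e : nat -> A) (S : set A) : (forall k, e k != 0) ->
  (forall d, S d -> exists x, asym_eigen e d x) ->
  forall d, closure S d -> exists x, asym_eigen e d x.
Proof.
move=> e0 hS d /closure_approx cld; apply: asym_eigen_limit => // eps /cld[y Sy dy].
by have [x hx] := hS _ Sy; exists y, x.
Qed.

Definition spectrum_eval (A : cstarType R) (D : set A) (d : D) (chi : gelfand_spectrum D) : R :=
  complex.Re ((\val chi : D -> R[i]) d).

Lemma spectrum_eval_continuous (A : cstarType R) (D : set A) (d : D) :
  continuous (@spectrum_eval A D d).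
Proof.
move=> chi.
have ct : (fun chi' : gelfand_spectrum D => (\val chi' : D -> R[i]) d : R[i]^o) @ chi -->
    ((\val chi : D -> R[i]) d : R[i]^o).
  apply: (@cvg_comp _ _ _ \val (fun f : {ptws D -> R[i]} => f d) (nbhs chi)
    (nbhs (\val chi : {ptws D -> R[i]}))); first exact: initial_continuous.
  exact: (@proj_continuous D (fun=> R[i]) d).
apply/(@cvgrPdist_lt _ R^o _ _ (nbhs_filter chi)) => e e0.
have := @cvgr_dist_lt _ R[i]^o _ _ (nbhs_filter chi) _ _ ct e%:C.
rewrite ltcR => /(_ e0); apply: filterS => chi'; rewrite cabsE ltcR.
exact: (le_lt_trans (cabs_ReB _ _)).
Qed.

Lemma gelfand_spectrum_cvg (A : cstarType R) (D : set A) (y : nat -> gelfand_spectrum D)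
    (x : gelfand_spectrum D) :
  (forall d (e : R), 0 < e -> exists N, forall n, (N <= n)%N ->
     cabs ((\val x : D -> R[i]) d - (\val (y n) : D -> R[i]) d) < e) -> y @ \oo --> x.
Proof.
move=> h B [C [[V openV VC] Cx CB]].
have : (fun n => \val (y n) : {ptws D -> R[i]}) @ \oo --> (\val x : {ptws D -> R[i]}).
  apply/pointwise_cvgP => d.
  apply/(@cvgrPdist_lt _ R[i]^o) => e /gtc0_real[r r0 ->]; have [N hN] := h d r r0.
  by exists N => // n Nn; rewrite /= cabsE ltcR; exact: hN.
move=> /(_ V)[|N _ hN].
  by apply: open_nbhs_nbhs; split=> //; move: Cx; rewrite -VC.
by exists N => // n Nn; apply: CB; rewrite -VC; exact: hN.
Qed.

End Spectrum.

(** * Threads of elements excising characters *)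

Section Tower.
Context {R : realType}.
Local Notation I := (set_type (`[0, 1] : set R)).
Local Notation h := (@h_fun R).
Variables (A : cstarType R) (L M K : nat -> nat).
Hypotheses (hL : forall n, (2 <= L n)%N) (hM : forall n, (2 <= M n)%N).
Hypothesis hK : forall n, (2 <= K n)%N.
Hypothesis hLS : forall n, L n.+1 = next_L (L n) (M n) (K n).
Variables (c : nat -> nat -> A) (s : nat -> A).
Variables (Psi : forall n, (I -> 'M[R[i]]_(next_L (L n) (M n) (K n))) -> A)
  (Theta : nat -> (I -> 'M[R[i]]_2) -> A).
Local Notation N n := (next_L (L n) (M n) (K n)).
Local Notation E n f i j := (@Psi n (elt_tensor (N n) f i j)).
Hypotheses (hPsi : forall n, cone_star_hom (@Psi n)) (hTheta : forall n, cone_star_hom (Theta n)).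
Hypothesis hc : forall n i, (1 <= i <= N n)%N -> E n Num.sqrt 1 i = c n.+1 i.
Hypothesis hs : forall n, Theta n (elt_tensor 2 Num.sqrt 1 2) = s n.+1.
Hypothesis rel_cs : forall n, c n 1%N * s n = s n.
Hypothesis rel_ortho : forall n i j, (1 <= i <= L n)%N -> (1 <= j <= L n)%N -> i != j ->
  (star (c n i) * c n i) * (star (c n j) * c n j) = 0.
Hypothesis rel_sum : forall n,
  \sum_(1 <= l < (L n).+1) star (c n l) * c n l + star (s n) * s n = 1.
Hypothesis conn_c : forall n l, (1 <= l <= L n)%N -> c n l = c_tilde (@Psi n) l.
Hypothesis conn_s : forall n, s n = s_tilde (@Psi n) (Theta n).

Definition last_col n := (K n * M n * L n + M n)%N.

(* Column [thread_col n k] at level [k + n + 1]: it starts at the last column *)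
(* of the first block and continues inside columns on which the building      *)
(* block is mapped to a point.                                                *)
Fixpoint thread_col n k : nat :=
  if k is j.+1 then
    ((thread_col n j).-1 * last_col (j.+1 + n) + K (j.+1 + n) * M (j.+1 + n) * L (j.+1 + n))%N
  else last_col n.

Definition thread n k : A := E (k + n) h (thread_col n k) (thread_col n k).

Lemma last_col_bound n : (1 <= last_col n <= N n)%N.
Proof.
apply/andP; split; first by rewrite /last_col; have := hM n; lia.
exact: (leW_n (hL n) (hM n) (hK n)).
Qed.

Lemma thread_col_bound n k : (1 <= thread_col n k <= N (k + n))%N.
Proof.
elim: k => [|k IH]; first exact: last_col_bound.
have m2 := hM (k.+1 + n)%N; have k2 := hK (k.+1 + n)%N; have l2 := hL (k.+1 + n)%N.
apply: (col_bound l2 m2 k2); first by rewrite addSn hLS.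
by rewrite leq_addr andbT !muln_gt0; lia.
Qed.

Lemma tower_cc n i : (1 <= i <= N n)%N -> star (c n.+1 i) * c n.+1 i = E n id i i.
Proof. by move=> iN; apply: (star_cc (hPsi n) (@hc n)) => //; lia. Qed.

Lemma thread_neq0 n k : thread n k != 0.
Proof.
apply: (cone_hom_h_fun_neq0 (hPsi _) (@hc _) (rel_cs _)); last exact: thread_col_bound.
  by rewrite -hLS; exact: rel_sum.
by have := thread_col_bound n k; lia.
Qed.

Lemma thread_norm n k : rnorm (thread n k) <= 1.
Proof.
apply: (cone_hom_norm_le (hPsi _)); [exact: thread_col_bound|exact: C0_h|move=> t /andP[t0 t1]].
by rewrite ger0_norm ?h_fun_ge0// h_funE; case: ltP => ?; lra.
Qed.

Lemma thread_excise n k (z := thread n k.+1) (q := thread_col n k) (m := (k + n).+1) :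
  star (c m q) * c m q * z = z /\ star (s m) * c m q * z = 0.
Proof.
have qL : (1 <= q <= L m)%N by rewrite hLS; exact: thread_col_bound.
have [h1 h2] := c_tilde_excise (hL m) (hM m) (hK m) (hPsi m) qL.
rewrite conn_c// conn_s -!mulrA h1 h2; split=> //.
apply: (s_tilde_excise (hL m) (hM m) (hK m) (hPsi m) (hTheta m) (@hc m) (hs m) (rel_cs _)).
exact: (thread_col_bound n k.+1).
Qed.

Let i01 : 0 <= (1 : R) <= 1. Proof. by rewrite lexx ler01. Qed.

Lemma thread_step n k : thread n k * thread n k.+1 = thread n k.+1.
Proof.
have qN := thread_col_bound n k.
have := cone_hom_eigen (hPsi _) qN i01 (@C0_h R) (z := thread n k.+1).
rewrite h_fun1 !scale1r; apply; rewrite -tower_cc//.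
by have [] := thread_excise n k.
Qed.

Lemma thread_mul n j k : (j < k)%N -> thread n j * thread n k = thread n k.
Proof.
elim: k => // k IH; rewrite ltnS leq_eqVlt => /orP[/eqP ->|jk]; first exact: thread_step.
by rewrite -(thread_step n k) mulrA IH.
Qed.

Lemma thread_excise_later n k k' (z := thread n k') (q := thread_col n k) (m := (k + n).+1) :
  (k < k')%N -> star (c m q) * c m q * z = z /\ star (s m) * c m q * z = 0.
Proof.
rewrite /z leq_eqVlt => /orP[/eqP <-|kk]; first exact: thread_excise.
have [h1 h2] := thread_excise n k; rewrite -(thread_mul n kk).
by rewrite !mulrA h1 h2 mul0r.
Qed.

(** Downward induction on the level. At level [n] the thread has the value 1 at the last column of
    the first block of the next level and 0 at the others; below, every [c] of the level above
    already kills it. [c_tilde_kill] covers both cases. *)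
Lemma thread_kill n k m : (m <= n)%N -> (1 <= k)%N ->
  forall i, (1 <= i <= L m)%N -> c m i * thread n k = 0.
Proof.
move=> mn k1; rewrite -(subKn mn).
elim: (n - m)%N (leq_subr m n) => [_|j IH jn] i.
  rewrite subn0 => iL; rewrite conn_c//.
  apply: (c_tilde_kill (hL n) (hM n) (hK n) (hPsi n)) => // a aN.
  rewrite -/(last_col n); have [hW _] := thread_excise_later n k1.
  have [->|aW] := eqVneq a (last_col n).
    by right; split=> //; rewrite -tower_cc//; exact: last_col_bound.
  have := @rel_ortho n.+1; rewrite hLS => hO.
  by left; rewrite -tower_cc// -mulrA (ortho_kill hO (last_col_bound n) aN aW hW) mulr0.
have jS : (n - j = (n - j.+1).+1)%N by rewrite subnSK.
move=> iL; rewrite conn_c//; set m' := (n - j.+1)%N in jS iL *.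
apply: (c_tilde_kill (hL m') (hM m') (hK m') (hPsi m')) => // a aN; left.
by rewrite -tower_cc// -mulrA -jS IH ?mulr0 ?jS ?hLS// ltnW.
Qed.

(** Up to level [n] all [star c_i * c_i] have the value 0; above, exactly the one at the column of
    the thread has the value 1. *)
Lemma thread_gens n m d : Dtilde_gens (L m) (c m) (s m) d -> exists x, asym_eigen (thread n) d x.
Proof.
move=> Gd; have [mn|nm] := leqP m n.
  have [x hx] := eigen_gens (rel_sum m) (fun=> 0) Gd.
  exists x; apply: (asym_eigen_exact (N := 1%N)) => k k1; apply: hx => i iL.
    by rewrite scale0r -mulrA thread_kill ?mulr0.
  by rewrite -mulrA thread_kill ?mulr0.
have [k mE] : exists k, m = (k + n).+1 by exists (m - n.+1)%N; lia.
have [x hx] := eigen_gens (rel_sum m) (fun i => (i == thread_col n k)%:R) Gd.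
exists x; apply: (asym_eigen_exact (N := k.+1)) => k' kk'.
have [h1 h2] := thread_excise_later n kk'; rewrite -mE in h1 h2.
have qL : (1 <= thread_col n k <= L m)%N by rewrite mE hLS; exact: thread_col_bound.
apply: hx => i iL; have [->|iq] := eqVneq i (thread_col n k); rewrite ?scale1r ?scale0r//.
  by rewrite -mulrA (ortho_kill (@rel_ortho m) qL iL iq h1) mulr0.
by rewrite -mulrA (ortho_kill (@rel_ortho m) qL iL iq h1) mulr0.
Qed.

(** A diagonal choice across threads: [base n] is killed by every [c] of the levels up to [n]. Index
    1 is the first to which [thread_kill] applies. *)
Definition base n : A := thread n 1.

Lemma base_gens m d : Dtilde_gens (L m) (c m) (s m) d -> exists x, asym_eigen base d x.
Proof.
move=> Gd; have [x hx] := eigen_gens (rel_sum m) (fun=> 0) Gd.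
exists x; apply: (asym_eigen_exact (N := m)) => n mn; apply: hx => i iL.
  by rewrite scale0r -mulrA thread_kill ?mulr0.
by rewrite -mulrA thread_kill ?mulr0.
Qed.

Lemma base_cc m i : (1 <= i <= L m)%N -> asym_eigen base (star (c m i) * c m i) 0.
Proof.
move=> iL; apply: (asym_eigen_exact (N := m)) => n mn.
by rewrite -mulrA thread_kill// mulr0 scale0r.
Qed.

Lemma base_ss m : asym_eigen base (star (s m) * s m) 1.
Proof.
apply: (asym_eigen_exact (N := m)) => n mn; rewrite scale1r.
by apply: (kill_star_ss (rel_sum m)) => i iL; rewrite thread_kill.
Qed.

Lemma thread_last_cc n :
  asym_eigen (thread n) (star (c n.+1 (last_col n)) * c n.+1 (last_col n)) 1.
Proof.
apply: (asym_eigen_exact (N := 1%N)) => k k1; rewrite scale1r.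
by have [] := thread_excise_later n k1.
Qed.

(* [base n] absorbs the tail of [thread n], so the character excised by       *)
(* [thread n] inherits the approximate eigenvalues of [base].                 *)
Lemma thread_base_dist n d x y (eps : R) :
  rnorm (d * base n - x *: base n) <= eps * rnorm (base n) -> 0 <= eps ->
  asym_eigen (thread n) d y -> cabs (x - y) <= eps.
Proof.
move=> hx eps0 hy; apply/ler_addgt0Pr => e e0.
have [k hk] := hy _ e0.
(* An index beyond 1, so that [base n] absorbs this element of the thread. *)
have := hk (maxn k 2) (leq_maxl _ _); set k' := maxn k 2 => hk'.
have b1 : base n * thread n k' = thread n k' by apply: thread_mul; rewrite /k'; lia.
have hx' : rnorm (d * thread n k' - x *: thread n k') <= eps * rnorm (thread n k').
  rewrite -b1 scalerAl mulrA -mulrBl; apply: le_trans (rnormM _ _) _; rewrite b1.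
  rewrite ler_wpM2r ?rnorm_ge0//; apply: le_trans hx _.
  by rewrite -[leRHS]mulr1 ler_wpM2l// thread_norm.
have := eigen_dist (@thread_neq0 n) hx' hk'; rewrite subrr rnorm0; lra.
Qed.

(** * Failure of local connectedness *)

Section LimitSpectrum.
Variable D : set A.
Hypothesis D_eigen : forall e : nat -> A, (forall k, e k != 0) ->
  (forall m d, Dtilde_gens (L m) (c m) (s m) d -> exists x, asym_eigen e d x) ->
  forall d, D d -> exists x, asym_eigen e d x.
Hypothesis D_cc : forall m i, (1 <= i <= L m)%N -> D (star (c m i) * c m i).
Hypothesis D_ss : forall m, D (star (s m) * s m).
Hypothesis D_E : forall m q f, (1 <= q <= N m)%N -> C0 f -> D (E m f q q).

Let N1 m : (1 <= 1 <= N m)%N.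
Proof. by have := last_col_bound m; lia. Qed.

Let L1 m : (1 <= 1 <= L m)%N.
Proof. by have := hL m; lia. Qed.

Definition first_cc m : D := exist _ (star (c m 1%N) * c m 1%N) (mem_set (D_cc (L1 m))).

Lemma last_colL m : (1 <= last_col m <= L m.+1)%N.
Proof. by rewrite hLS; exact: last_col_bound. Qed.

Definition last_cc m : D :=
  exist _ (star (c m.+1 (last_col m)) * c m.+1 (last_col m)) (mem_set (D_cc (last_colL m))).

Lemma first_cc_descend (chi : D -> R[i]) m : character chi ->
  chi (first_cc m.+1) = 1 -> chi (first_cc m) = 1.
Proof.
move=> hchi h1; apply: (character_value_one hchi (hPsi m) (N1 m) (fun f => D_E (N1 m)) (@C0_g R)
  (a := first_cc m.+1)); rewrite ?h1 ?oner_neq0//.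
- exact: tower_cc.
- by rewrite /= tower_cc// conn_c// c_tilde1_cc_first.
- by move=> t _; rewrite ler_norml => /andP[h2 _]; apply: g_fun_eq1; move: h2 => /=; lra.
Qed.

(** On the window from 1/4 to 3/4 around 1/2, [g = 1] and [h = 0], so [g - h = 1] there. *)
Lemma first_cc_of_last (chi : D -> R[i]) m : character chi ->
  complex.Re (chi (last_cc m)) = 1 / 2 -> chi (first_cc m) = 1.
Proof.
move=> hchi h1; have cb := last_col_bound m.
apply: (character_value_one hchi (hPsi m) cb (fun f => D_E cb) (C0B (@C0_g R) (@C0_h R))
  (a := last_cc m)).
- exact: tower_cc.
- by rewrite /= tower_cc// conn_c// c_tilde1_cc_last.
- by apply/eqP => h0; move: h1; rewrite h0 /=; lra.
move=> t _; rewrite h1 ler_norml => /andP[h2 h3].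
by rewrite g_fun_eq1 ?h_fun_eq0 ?subr0//; lra.
Qed.

Lemma tower_spectrum_not_locally_connected : not_locally_connected (gelfand_spectrum D).
Proof.
have base0 k : base k != 0 by exact: thread_neq0.
have base1 : exists2 d, D d & asym_eigen base d 1.
  by exists (star (s 0) * s 0); [exact: D_ss|exact: base_ss].
have thread1 n : exists2 d, D d & asym_eigen (thread n) d 1.
  exists (star (c n.+1 (last_col n)) * c n.+1 (last_col n)); last exact: thread_last_cc.
  exact: D_cc (last_colL n).
have [x [hx ex]] := excision_character base0 (D_eigen base0 (@base_gens)) base1.
have hy n := excision_character (@thread_neq0 n) (D_eigen (@thread_neq0 n) (@thread_gens n))
  (thread1 n).
pose X := gelfand_spectrum D.
pose xX : X := exist _ (x : {ptws D -> R[i]}) (mem_set hx).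
pose y n := projT1 (cid (hy n)).
have [yc ey] : (forall n, character (y n)) /\
    forall n d, asym_eigen (thread n) (\val d) (y n d).
  by split=> n; rewrite /y; case: cid => ? [].
pose yX n : X := exist _ (y n : {ptws D -> R[i]}) (mem_set (yc n)).
(* An estimate for [x] along [base n] transfers to [y n], since [base n] is an element of thread
   [n]. *)
have yx : yX @ \oo --> xX.
  apply: gelfand_spectrum_cvg => d e e0; have e2 : 0 < e / 2 by lra.
  have [n0 hn0] := ex d _ e2; exists n0 => n /hn0 hn.
  by have := thread_base_dist hn (ltW e2) (ey n d); rewrite /=; lra.
exists xX => -[B BV Bbase].
have xfirst m : x (first_cc m) = 0.
  exact: (asym_eigen_uniq base0 (d := \val (first_cc m)) (ex _) (base_cc (L1 m))).
have xlast m : x (last_cc m) = 0.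
  exact: (asym_eigen_uniq base0 (d := \val (last_cc m)) (ex _) (base_cc (last_colL m))).
have ylast n : y n (last_cc n) = 1.
  exact: (asym_eigen_uniq (@thread_neq0 n) (d := \val (last_cc n)) (ey n _) (@thread_last_cc n)).
have [|V /BV[nV cV] VU] := Bbase [set chi : X | spectrum_eval (first_cc 0) chi < 1 / 2].
  apply: (@spectrum_eval_continuous R A D (first_cc 0) xX [set r | r < 1 / 2]).
  apply: open_nbhs_nbhs; split; first exact: open_lt.
  by rewrite /spectrum_eval /= xfirst /=; lra.
have [n _ hn] := yx V nV; have Vy := hn n (leqnn n).
(* The image is an interval containing 0, from [x], and 1, from [y n], hence also 1/2. *)
have : connected (spectrum_eval (last_cc n) @` V).
  apply: connected_continuous_connected => //.
  by apply: continuous_subspaceT => chi; exact: spectrum_eval_continuous.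
move/connected_intervalP => /(_ 0 1).
case/(_ _ _ (1 / 2)) => [||/=|chi Vchi chi12].
- by exists xX; [exact: nbhs_singleton|rewrite /spectrum_eval /= xlast].
- by exists (yX n) => //; rewrite /spectrum_eval /= ylast.
- by apply/andP; split; lra.
have chic : character (\val chi : D -> R[i]) by exact: set_valP chi.
have chi0 : (\val chi : D -> R[i]) (first_cc 0) = 1.
  (* The value 1 starts at level [n] and descends to level 0. *)
  have := first_cc_of_last chic chi12.
  by elim: n {hn Vy chi12} => // n IH /(first_cc_descend chic).
by have := VU chi Vchi; rewrite /spectrum_eval /= chi0 /=; lra.
Qed.

End LimitSpectrum.
End Tower.

(** * Transfer along *-homomorphisms *)

Lemma cstar_generated_subalgebra (R : realType) (A : cstarType R) (G : set A) :
  cstar_subalgebra (cstar_generated G).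
Proof.
split.
- by move=> S [[]].
- move=> a x y Sx Sy S hS; have [[_ h _ _ _] _] := hS; apply: h; [exact: Sx|exact: Sy].
- move=> x y Sx Sy S hS; have [[_ _ h _ _] _] := hS; apply: h; [exact: Sx|exact: Sy].
- by move=> x Sx S hS; have [[_ _ _ h _] _] := hS; apply: h; exact: Sx.
- by apply: closed_bigI => S [[]].
Qed.

Section StarHomTransfer.
Context {R : realType}.
Local Notation I := (set_type (`[0, 1] : set R)).
Variables (A B : cstarType R) (f : A -> B).
Hypothesis hf : star_hom f.

Lemma star_hom_sum m (F : nat -> A) :
  f (\sum_(1 <= i < m) F i) = \sum_(1 <= i < m) f (F i).
Proof. exact: (big_morph f (star_homD hf) (star_hom0 hf)). Qed.

Lemma cone_star_hom_comp n (Psi : (I -> 'M[R[i]]_n) -> A) :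
  cone_star_hom Psi -> cone_star_hom (f \o Psi).
Proof.
case: hf => flin [_ fM] fs [hl hm hs]; split=> [a x y cx cy|x y cx cy|x cx] /=.
- by rewrite hl// flin.
- by rewrite hm// fM.
- by rewrite hs// fs.
Qed.

Lemma star_hom_c_tilde L M K (Psi : (I -> 'M[R[i]]_(next_L L M K)) -> A) l :
  f (c_tilde Psi l) = c_tilde (f \o Psi) l.
Proof. by rewrite (star_homD hf) !star_hom_sum. Qed.

Lemma star_hom_s_tilde L M K (Psi : (I -> 'M[R[i]]_(next_L L M K)) -> A)
    (Theta : (I -> 'M[R[i]]_2) -> A) :
  f (s_tilde Psi Theta) = s_tilde (f \o Psi) (f \o Theta).
Proof.
rewrite (star_homD hf) star_hom_sum; congr (_ + _).
by apply: eq_bigr => l _; rewrite star_hom_sum.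
Qed.

Lemma Ztilde_relations_hom L (c : nat -> A) (s : A) : Ztilde_relations L c s ->
  [/\ f (c 1%N) * f s = f s,
      forall i j, (1 <= i <= L)%N -> (1 <= j <= L)%N -> i != j ->
        (star (f (c i)) * f (c i)) * (star (f (c j)) * f (c j)) = 0
    & \sum_(1 <= l < L.+1) star (f (c l)) * f (c l) + star (f s) * f s = 1].
Proof.
case: hf => _ [f1 fM] fs [_ _ ho cs hsum]; split; first by rewrite -fM cs.
  by move=> i j iL jL ij; rewrite -!fs -!fM ho// (star_hom0 hf).
rewrite -f1 -hsum (star_homD hf) star_hom_sum fM fs; congr (_ + _).
by apply: eq_bigr => l _; rewrite fM fs.
Qed.

End StarHomTransfer.

Theorem proposition5p5 (R : realType) (L K M : nat -> nat)
  (hL : (2 <= L 0)%N)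
  (hK : forall n, (2 <= K n)%N)
  (hM : forall n, (2 <= M n)%N)
  (hLS : forall n, L n.+1 = next_L (L n) (M n) (K n))
  (Z : nat -> cstarType R) (c : forall n, nat -> Z n) (s : forall n, Z n)
  (hZ : forall n, is_Ztilde (L n) (c n) (s n))
  (Phi : forall n, Z n -> Z n.+1)
  (hPhi : forall n, connecting_hom (L n) (M n) (K n)
                      (c n) (s n) (c n.+1) (s n.+1) (Phi n))
  (A : cstarType R) (phi : forall n, Z n -> A)
  (hA : inductive_limit Phi phi)
  (J : cstarType R) (hJ : jiang_su J) (hAJ : star_isomorphic A J) :
  not_locally_connected
    (gelfand_spectrum (limit_subalgebra phi (fun n => Dtilde (L n) (c n) (s n)))).
Proof.
have [hphi phiP _ _] := hA.
have L2 n : (2 <= L n)%N.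
  elim: n => // n IH; rewrite hLS next_LE.
  by have := hM n; have := hK n; nia.
pose PsiZ n := projT1 (cid (hPhi n)).
pose ThetaZ n := projT1 (cid (projT2 (cid (hPhi n)))).
have hconn n : [/\ cone_star_hom (PsiZ n) /\
        (forall i, (1 <= i <= next_L (L n) (M n) (K n))%N ->
           PsiZ n (elt_tensor _ Num.sqrt 1 i) = c n.+1 i),
        cone_star_hom (ThetaZ n) /\ ThetaZ n (elt_tensor _ Num.sqrt 1 2) = s n.+1,
        star_hom (@Phi n),
        forall l, (1 <= l <= L n)%N -> Phi n (c n l) = c_tilde (PsiZ n) l
      & Phi n (s n) = s_tilde (PsiZ n) (ThetaZ n)].
  exact: (projT2 (cid (projT2 (cid (hPhi n))))).
(* After composing with the maps into [A] all generators live in one algebra, and compatibility of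
   [phi] with [Phi] turns the connecting maps into the equations [conn_c] and [conn_s]. *)
pose Psi n := phi n.+1 \o PsiZ n; pose Theta n := phi n.+1 \o ThetaZ n.
pose c' n i := phi n (c n i); pose s' n := phi n (s n).
have hPsi n : cone_star_hom (Psi n) by apply: cone_star_hom_comp => //; have [[]] := hconn n.
have hTheta n : cone_star_hom (Theta n).
  by apply: cone_star_hom_comp => //; have [_ []] := hconn n.
have hc n i : (1 <= i <= next_L (L n) (M n) (K n))%N ->
    Psi n (elt_tensor _ Num.sqrt 1 i) = c' n.+1 i.
  by move=> iN; rewrite /Psi /=; have [[_ ->]] := hconn n.
have hs n : Theta n (elt_tensor 2 Num.sqrt 1 2) = s' n.+1.
  by rewrite /Theta /=; have [_ [_ ->]] := hconn n.
have hrel n := Ztilde_relations_hom (hphi n) (hZ n).1.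
have rel_cs n : c' n 1%N * s' n = s' n by have [] := hrel n.
have rel_ortho n i j (iL : (1 <= i <= L n)%N) (jL : (1 <= j <= L n)%N) (ij : i != j) :
  (star (c' n i) * c' n i) * (star (c' n j) * c' n j) = 0 by have [_ + _] := hrel n; apply.
have rel_sum n : \sum_(1 <= l < (L n).+1) star (c' n l) * c' n l + star (s' n) * s' n = 1.
  by have [] := hrel n.
have conn_c n l : (1 <= l <= L n)%N -> c' n l = c_tilde (Psi n) l.
  move=> lL; rewrite /c' -phiP; have [_ _ _ h _] := hconn n; rewrite h//.
  exact: star_hom_c_tilde.
have conn_s n : s' n = s_tilde (Psi n) (Theta n).
  rewrite /s' -phiP; have [_ _ _ _ h] := hconn n; rewrite h; exact: star_hom_s_tilde.
set D := limit_subalgebra _ _.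
have Dphi n d : Dtilde (L n) (c n) (s n) d -> D (phi n d).
  by move=> Dd; apply: subset_closure; exists n => //; exists d.
(* Eigenvalues pass from the generators to the generated algebras and then to the closure of their
   union. *)
have hasym (e : nat -> A) : (forall k, e k != 0) ->
    (forall m d, Dtilde_gens (L m) (c' m) (s' m) d -> exists x, asym_eigen e d x) ->
    forall d, D d -> exists x, asym_eigen e d x.
  move=> e0 he; apply: asym_eigen_closure => // _ [m _ [d Dd <-]].
  apply: (asym_eigen_generated (hphi m) e0 _ _ Dd); first exact: Dtilde_gens_star.
  by move=> d' /(Dtilde_gens_hom (hphi m)); exact: he.
have gensD n d : Dtilde_gens (L n) (c n) (s n) d -> Dtilde (L n) (c n) (s n) d.
  exact: sub_gen_smallest.
have gens_cc n i : (1 <= i <= L n)%N -> D (star (c' n i) * c' n i).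
  move=> iL; have [_ [_ fM] fs] := hphi n; rewrite /c' -fs -fM; apply: Dphi.
  by apply: gensD; left; left; left; exists i.
have gens_ss n : D (star (s' n) * s' n).
  have [_ [_ fM] fs] := hphi n; rewrite /s' -fs -fM; apply: Dphi.
  by apply: gensD; left; left; right.
have D_E m q f : (1 <= q <= next_L (L m) (M m) (K m))%N -> C0 f ->
    D (Psi m (elt_tensor _ f q q)).
  move=> qN f0; apply: Dphi; have [[hPZ hcZ] _ _ _ _] := hconn m.
  apply: (cone_hom_mem hPZ qN (cstar_generated_subalgebra _) _ f0).
  have qL : (1 <= q <= L m.+1)%N by rewrite hLS.
  have n1 : (1 <= next_L (L m) (M m) (K m))%N by lia.
  rewrite -(star_cc hPZ hcZ n1 qN).
  by apply: gensD; left; left; left; exists q.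
apply: (tower_spectrum_not_locally_connected L2 hM hK hLS hPsi hTheta hc hs rel_cs rel_ortho
  rel_sum conn_c conn_s hasym gens_cc gens_ss D_E).
Qed.
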